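(* Let $n\in\{2,3\}$. Suppose that $\nu\ge2$, that $s_1,\dots,s_\nu:\mathbb{R}^{n-1}\to\mathbb{R}^{n-1}$ are contractions, and that the non-empty compact set $\Gamma\subset\mathbb{R}^{n-1}$ is the unique attractor of the iterated function system $\{s_1,\dots,s_\nu\}$, i.e. the unique non-empty compact set satisfying $\Gamma=s(\Gamma)$, where $s(U):=\bigcup_{m=1}^\nu s_m(U)$ for $U\subset\mathbb{R}^{n-1}$. Suppose that $\Gamma_0\subset\mathbb{R}^{n-1}$ is non-empty and compact with $s(\Gamma_0)\subset\Gamma_0$, and define the sequence of compact sets $\Gamma_j$ by $\Gamma_{j+1}:=s(\Gamma_j)$, $j=0,1,\dots$. Then BVP convergence holds, i.e. $H^{-1/2}_{\Gamma_j}$ Mosco-converges to $H^{-1/2}_\Gamma$ in $H^{-1/2}(\mathbb{R}^{n-1})$ as $j\to\infty$.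
   Context: A map $s_m:\mathbb{R}^{n-1}\to\mathbb{R}^{n-1}$ is a contraction if $|s_m(x)-s_m(y)|\le c|x-y|$ for all $x,y$, for some $c\in(0,1)$. Sobolev spaces: $H^s(\mathbb{R}^m)$ is the Hilbert space of tempered distributions $u$ whose Fourier transform is locally integrable with $\|u\|_{H^s(\mathbb{R}^m)}^2=\int_{\mathbb{R}^m}(1+|\xi|^2)^s|\hat u(\xi)|^2\,d\xi<\infty$. For $F\subset\mathbb{R}^m$ closed, $H^s_F=\{u\in H^s(\mathbb{R}^m):\operatorname{supp}u\subset F\}$. Mosco convergence: closed subspaces $W_j$ of a Hilbert space $H$ Mosco-converge to a closed subspace $W$ of $H$ if (i) for every $w\in W$ there exist $w_j\in W_j$ with $\|w_j-w\|_H\to0$; and (ii) if $(W_{j_m})$ is a subsequence of $(W_j)$, $w_m\in W_{j_m}$ for $m\in\mathbb{N}$, and $w_m\rightharpoonup w$ weakly in $H$, then $w\in W$. ''BVP convergence'' for compact sets $\Gamma_j$, $\Gamma$ is by definition this Mosco convergence of $H^{-1/2}_{\Gamma_j}$ to $H^{-1/2}_\Gamma$. *)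

(* Defs.v *)
From HB Require Import structures.
From mathcomp Require Import all_boot all_order all_algebra.
From mathcomp Require Import complex.
From mathcomp Require Import all_classical all_reals all_analysis.

Set Implicit Arguments.
Unset Strict Implicit.
Unset Printing Implicit Defensive.
Import Order.TTheory GRing.Theory Num.Theory.
Import numFieldNormedType.Exports.
Import ComplexField.Normc.

Local Open Scope classical_set_scope.
Local Open Scope complex_scope.
Local Open Scope ring_scope.

Section euclidean.
Context {R : realType} {m : nat}.
Implicit Types x y : 'rV[R]_m.

Definition dotr x y : R := \sum_(i < m) x 0 i * y 0 i.

(* The library norm `|x| on 'rV[R]_m is the sup norm. *)
Definition enorm x : R := Num.sqrt (dotr x x).

End euclidean.

(* Lebesgue measure on R^m, by iterated products; 'rV[R]_m carries the
   sigma-algebra generated by the coordinates, i.e. the Borel one. *)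
Section rV_measurable.
Context {R : realType} {m : nat}.

Definition rV_coord (i : 'I_m) (x : 'rV[R]_m) : R := x 0 i.

Let rV_set0 : g_sigma_preimage rV_coord set0.
Proof. exact: sigma_algebra0. Qed.

Let rV_setC A : g_sigma_preimage rV_coord A -> g_sigma_preimage rV_coord (~` A).
Proof. exact: sigma_algebraC. Qed.

Let rV_bigcup (F : _^nat) : (forall i, g_sigma_preimage rV_coord (F i)) ->
  g_sigma_preimage rV_coord (\bigcup_i (F i)).
Proof. exact: sigma_algebra_bigcup. Qed.

HB.instance Definition _ := @isMeasurable.Build default_measure_display
  'rV[R]_m (g_sigma_preimage rV_coord) rV_set0 rV_setC rV_bigcup.

Lemma measurable_rV_coord i : measurable_fun setT (rV_coord i).
Proof.
move=> _ Y mY; rewrite setTI; apply: sub_sigma_algebra.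
rewrite -bigcup_seq/=; exists i => /=; first by rewrite mem_index_enum.
by exists Y => //; rewrite setTI.
Qed.

Lemma measurable_fun_rVP d (T : measurableType d) (f : T -> 'rV[R]_m) :
  (forall i, measurable_fun setT (rV_coord i \o f)) -> measurable_fun setT f.
Proof.
move=> mf _ A mA; rewrite setTI.
suff : g_sigma_preimage rV_coord `<=` [set B | measurable (f @^-1` B)] by exact.
apply: smallest_sub.
- split => /=.
  + by rewrite preimage_set0.
  + by move=> B mB; rewrite setTD preimage_setC; exact: measurableC.
  + by move=> F mF; rewrite preimage_bigcup; exact: bigcupT_measurable.
- rewrite -bigcup_seq/= => _ [i _] [B mB <-] /=.
  by rewrite setTI -[X in measurable X]setTI -comp_preimage; exact: mf.
Qed.

End rV_measurable.

Section rV_cons.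
Context {R : realType} {m : nat}.

Definition rV_cons (p : measurableTypeR R * 'rV[R]_m) : 'rV[R]_m.+1 :=
  \row_i (if unlift ord0 i is Some j then p.2 0 j else p.1).

Definition rV_uncons (x : 'rV[R]_m.+1) : measurableTypeR R * 'rV[R]_m :=
  (x 0 ord0, \row_j x 0 (lift ord0 j)).

Lemma rV_consK : cancel rV_cons rV_uncons.
Proof.
case=> a v; congr pair; first by rewrite mxE unlift_none.
by apply/rowP => j; rewrite !mxE liftK.
Qed.

Lemma measurable_rV_cons : measurable_fun setT rV_cons.
Proof.
apply: measurable_fun_rVP => i.
case: (unliftP ord0 i) => [j ->|->].
- rewrite (_ : _ \o _ = rV_coord j \o snd).
    exact: (measurableT_comp (measurable_rV_coord j) measurable_snd).
  by apply/funext => p; rewrite /= /rV_coord mxE liftK.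
- rewrite (_ : _ \o _ = fst).
    exact: measurable_fst.
  by apply/funext => p; rewrite /= /rV_coord mxE unlift_none.
Qed.

Lemma measurable_rV_uncons : measurable_fun setT rV_uncons.
Proof.
apply/measurable_fun_pairP; split; first exact: measurable_rV_coord.
apply: measurable_fun_rVP => i.
rewrite (_ : _ \o _ = rV_coord (lift ord0 i)); first exact: measurable_rV_coord.
by apply/funext => x; rewrite /= /rV_coord mxE.
Qed.

End rV_cons.

Section lebesgue_rV.
Context {R : realType}.

Section step.
Context {m : nat} (mu : {sigma_finite_measure set 'rV[R]_m -> \bar R}).

Definition lebesgue_rV_step : set 'rV[R]_m.+1 -> \bar R :=
  pushforward (lebesgue_measure \x mu)%E rV_cons.

Let step0 : lebesgue_rV_step set0 = 0%E.
Proof. by rewrite /lebesgue_rV_step /pushforward preimage_set0 measure0. Qed.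

Let step_ge0 A : (0 <= lebesgue_rV_step A)%E.
Proof. by rewrite /lebesgue_rV_step /pushforward; exact: measure_ge0. Qed.

Let step_sigma_additive : semi_sigma_additive lebesgue_rV_step.
Proof.
move=> F mF tF mUF; rewrite /lebesgue_rV_step /pushforward preimage_bigcup.
have mcons A : measurable A -> measurable (@rV_cons R m @^-1` A).
  by move=> mA; rewrite -[X in measurable X]setTI; exact: measurable_rV_cons.
apply: measure_semi_sigma_additive.
- by move=> k; exact: mcons.
- apply/trivIsetP => /= i j _ _ ij; rewrite -preimage_setI.
  by move/trivIsetP : tF => /(_ _ _ _ _ ij) ->//; rewrite preimage_set0.
- by rewrite -preimage_bigcup; exact: mcons.
Qed.

HB.instance Definition _ := isMeasure.Build _ _ _ lebesgue_rV_step
  step0 step_ge0 step_sigma_additive.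

Let step_sigma_finite : sigma_finite setT lebesgue_rV_step.
Proof.
have /sigma_finiteP[F [FT ndF Ffin]] := sigma_finiteT (@lebesgue_measure R).
have /sigma_finiteP[G [GT ndG Gfin]] := sigma_finiteT mu.
exists (fun k => rV_uncons @^-1` (F k `*` G k)).
  rewrite -preimage_bigcup (_ : \bigcup_k _ = setT) ?preimage_setT//.
  rewrite -subTset => -[x y] _.
  have [i _ Fix] : (\bigcup_k F k) x by rewrite -FT.
  have [j _ Gjy] : (\bigcup_k G k) y by rewrite -GT.
  exists (maxn i j) => //; split => /=.
  - by move: x Fix; exact/subsetPset/ndF/leq_maxl.
  - by move: y Gjy; exact/subsetPset/ndG/leq_maxr.
move=> k; have [mF ltF] := Ffin k; have [mG ltG] := Gfin k; split.
  rewrite -[X in measurable X]setTI; apply: measurable_rV_uncons => //.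
  exact: measurableX.
rewrite /lebesgue_rV_step /pushforward -comp_preimage.
rewrite (_ : _ \o _ = id); last by apply/funext => p /=; exact: rV_consK.
rewrite preimage_id product_measure1E// lte_mul_pinfty// ge0_fin_numE//.
Qed.

HB.instance Definition _ := Measure_isSigmaFinite.Build _ _ _ lebesgue_rV_step
  step_sigma_finite.

End step.

Fixpoint lebesgue_rV (m : nat) : {sigma_finite_measure set 'rV[R]_m -> \bar R} :=
  if m is k.+1 then lebesgue_rV_step (lebesgue_rV k) else \d_(0 : 'rV[R]_0).

End lebesgue_rV.

Section complex_valued.
Context {R : realType} {m : nat}.
Implicit Types f g : 'rV[R]_m -> R[i].

Local Notation mu := (@lebesgue_rV R m).

Definition cintegrable (D : set 'rV[R]_m) f : Prop :=
  mu.-integrable D (EFin \o (fun x => complex.Re (f x))) /\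
  mu.-integrable D (EFin \o (fun x => complex.Im (f x))).

Definition cintegral f : R[i] :=
  (\int[mu]_x complex.Re (f x)) +i* (\int[mu]_x complex.Im (f x)).

Definition clocally_integrable f : Prop :=
  [/\ measurable_fun setT (fun x => complex.Re (f x)),
      measurable_fun setT (fun x => complex.Im (f x)) &
      forall K, compact K -> cintegrable K f].

Definition cdifferentiable f (x : 'rV[R]_m) : Prop :=
  differentiable (fun y => complex.Re (f y)) x /\
  differentiable (fun y => complex.Im (f y)) x.

Definition cpartial (i : 'I_m) f (x : 'rV[R]_m) : R[i] :=
  ('D_('e_i) (fun y => complex.Re (f y)) x) +i*
  ('D_('e_i) (fun y => complex.Im (f y)) x).

(* A multi-index is given as the sequence of directions of differentiation. *)
Definition cpartials (a : seq 'I_m) f : 'rV[R]_m -> R[i] := foldr cpartial f a.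

Definition csmooth f : Prop := forall a x, cdifferentiable (cpartials a f) x.

Definition is_schwartz f : Prop :=
  csmooth f /\
  forall (k : nat) (a : seq 'I_m), exists M : R,
    forall x, (1 + enorm x) ^+ k * normc (cpartials a f x) <= M.

Let derive_lin3 (p q : R) (f1 f2 f3 : 'rV[R]_m -> R) x v :
  differentiable f1 x -> differentiable f2 x -> differentiable f3 x ->
  'D_v (p \*: f1 + q \*: f2 + f3) x =
  p *: 'D_v f1 x + q *: 'D_v f2 x + 'D_v f3 x.
Proof.
move=> /(@diff_derivable _ _ _ _ _ v) d1 /(@diff_derivable _ _ _ _ _ v) d2.
move=> /(@diff_derivable _ _ _ _ _ v) d3.
have e1 : derivable (p \*: f1) x v by exact: derivableZ.
have e2 : derivable (q \*: f2) x v by exact: derivableZ.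
rewrite (deriveD (derivableD e1 e2) d3) (deriveD e1 e2).
by rewrite (deriveZ _ d1) (deriveZ _ d2).
Qed.

Lemma cpartialsD c f g : csmooth f -> csmooth g ->
  csmooth (c *: f + g) /\
  forall a, cpartials a (c *: f + g) = c *: cpartials a f + cpartials a g.
Proof.
move=> sf sg.
have ReE (u v : 'rV[R]_m -> R[i]) : (fun y => complex.Re ((c *: u + v) y)) =
    complex.Re c \*: (fun y => complex.Re (u y)) +
    (- complex.Im c) \*: (fun y => complex.Im (u y)) + (fun y => complex.Re (v y)).
  apply/funext => y; rewrite !fctE /=.
  by case: (c) (u y) (v y) => [c1 c2] [u1 u2] [v1 v2] /=; rewrite scaleNr.
have ImE (u v : 'rV[R]_m -> R[i]) : (fun y => complex.Im ((c *: u + v) y)) =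
    complex.Re c \*: (fun y => complex.Im (u y)) +
    complex.Im c \*: (fun y => complex.Re (u y)) + (fun y => complex.Im (v y)).
  apply/funext => y; rewrite !fctE /=.
  by case: (c) (u y) (v y) => [c1 c2] [u1 u2] [v1 v2].
have dD (u v : 'rV[R]_m -> R[i]) x : cdifferentiable u x ->
    cdifferentiable v x -> cdifferentiable (c *: u + v) x.
  move=> [u1 u2] [v1 v2]; split; rewrite ?ReE ?ImE.
    by apply: differentiableD => //; apply: differentiableD;
      exact: differentiableZ.
  by apply: differentiableD => //; apply: differentiableD;
    exact: differentiableZ.
have E a : cpartials a (c *: f + g) = c *: cpartials a f + cpartials a g.
  elim: a => //= i a ->; apply/funext => x.
  have [u1 u2] := sf a x; have [v1 v2] := sg a x.
  rewrite /cpartial ReE ImE (derive_lin3 _ _ _ u1 u2 v1).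
  rewrite (derive_lin3 _ _ _ u2 u1 v2).
  rewrite !fctE scaleNr; set u := 'D_('e_i) _ x; set v := 'D_('e_i) _ x.
  set w := 'D_('e_i) _ x; set z := 'D_('e_i) _ x.
  by rewrite /cpartial -/u -/v -/w -/z {dD ReE ImE}; case: c.
by split => // a x; rewrite E; apply: dD; [exact: sf|exact: sg].
Qed.

Lemma is_schwartz0 : is_schwartz 0.
Proof.
have E a : cpartials a 0 = 0.
  elim: a => //= i a ->; apply/funext => x.
  by rewrite /cpartial /= !derive_cst.
split=> [a x|k a]; first by rewrite E; split; exact: differentiable_cst.
by exists 0 => x; rewrite E normc0 mulr0.
Qed.

Lemma is_schwartzD c f g :
  is_schwartz f -> is_schwartz g -> is_schwartz (c *: f + g).
Proof.
move=> [sf bf] [sg bg]; have [sfg E] := cpartialsD c sf sg; split => // k a.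
have [M hM] := bf k a; have [N hN] := bg k a.
exists (normc c * M + N) => x; rewrite E /=.
have w0 : 0 <= (1 + enorm x) ^+ k.
  by rewrite exprn_ge0// addr_ge0// sqrtr_ge0.
apply: le_trans (_ : (1 + enorm x) ^+ k *
    (normc c * normc (cpartials a f x) + normc (cpartials a g x)) <= _).
  by rewrite ler_wpM2l// -normcM; exact: le_normcD.
rewrite mulrDr lerD// mulrCA ler_wpM2l//.
by case: (c) => c1 c2; exact: sqrtr_ge0.
Qed.

End complex_valued.

Section schwartz_space.
Variables (R : realType) (m : nat).

Definition schwartz_pred : {pred 'rV[R]_m -> R[i]} := fun f => `[< is_schwartz f >].

Record schwartz := Schwartz {
  schwartz_fun :> 'rV[R]_m -> R[i] ;
  schwartz_funP : schwartz_fun \in schwartz_pred }.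

HB.instance Definition _ := [isSub for schwartz_fun].
HB.instance Definition _ := [Choice of schwartz by <:].

Lemma schwartz_submod_closed : submod_closed schwartz_pred.
Proof.
split=> [|c f g]; first by apply/asboolP; exact: is_schwartz0.
move=> /asboolP sf /asboolP sg; apply/asboolP; exact: is_schwartzD.
Qed.

HB.instance Definition _ := GRing.isSubmodClosed.Build _ _ schwartz_pred
  schwartz_submod_closed.
HB.instance Definition _ := [SubChoice_isSubLmodule of schwartz by <:].

End schwartz_space.

Section tempered_distributions.
Context {R : realType} {m : nat}.

Local Notation mu := (@lebesgue_rV R m).
Local Notation S := (schwartz R m).

(* Unitary normalisation:
   (2 pi)^(-m/2) \int e^(- i xi.x) f(x) dx. *)
Definition fourier (f : 'rV[R]_m -> R[i]) (xi : 'rV[R]_m) : R[i] :=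
  ((Num.sqrt (2 * pi)) ^- m)%:C *
  cintegral (fun x => (cos (dotr xi x) -i* sin (dotr xi x)) * f x).

(* Convergence to 0 in the Frechet topology of the Schwartz space. *)
Definition schwartz_cvg0 (phi_ : nat -> S) : Prop :=
  forall (k : nat) (a : seq 'I_m) (e : R), 0 < e ->
    \forall j \near \oo,
      forall x, (1 + enorm x) ^+ k * normc (cpartials a (phi_ j) x) <= e.

(* The Schwartz space is metrizable, so that sequential continuity of a linear
   functional is continuity. *)
Definition tempered (u : S -> R[i]) : Prop :=
  scalar u /\
  forall phi_ : nat -> S, schwartz_cvg0 phi_ ->
    normc (u (phi_ j)) @[j --> \oo] --> (0 : R).

(* Fourier transform by duality: <Fu, phi> = <u, F phi>; since fourier maps the Schwartz space into
   itself, the default value 0 of insubd is never used. *)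
Definition dfourier (u : S -> R[i]) (phi : S) : R[i] :=
  u (insubd (0 : S) (fourier phi)).

(* u is the locally integrable function g, in the duality with the Schwartz
   space. For g in a weighted L^2 space, as in Hs below, g phi is always
   integrable and this is the same as equality as distributions. *)
Definition has_density (u : S -> R[i]) (g : 'rV[R]_m -> R[i]) : Prop :=
  clocally_integrable g /\
  forall phi : S, cintegrable setT (g \* phi) /\ u phi = cintegral (g \* phi).

(* The Fourier transform of u as a function, a.e. unique when it exists. *)
Definition fourier_density (u : S -> R[i]) : 'rV[R]_m -> R[i] :=
  xget (cst 0) [set g | has_density (dfourier u) g].

Definition Hs_sqnorm (s : R) (u : S -> R[i]) : \bar R :=
  \int[mu]_xi ((1 + enorm xi ^+ 2) `^ s * normc (fourier_density u xi) ^+ 2)%:E.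

Definition Hs_norm (s : R) (u : S -> R[i]) : R := Num.sqrt (fine (Hs_sqnorm s u)).

Definition Hs (s : R) : set (S -> R[i]) :=
  [set u | [/\ tempered u, exists g, has_density (dfourier u) g &
               (Hs_sqnorm s u < +oo)%E]].

Definition vanishes_on (u : S -> R[i]) (U : set 'rV[R]_m) : Prop :=
  forall phi : S, compact (closure [set x | phi x != 0]) ->
    closure [set x | phi x != 0] `<=` U -> u phi = 0.

Definition dsupp (u : S -> R[i]) : set 'rV[R]_m :=
  ~` \bigcup_(U in [set U | open U /\ vanishes_on u U]) U.

Definition Hs_in (s : R) (F : set 'rV[R]_m) : set (S -> R[i]) :=
  [set u | Hs s u /\ dsupp u `<=` F].

End tempered_distributions.

(* A complex Hilbert space is given here by its underlying set H, a linear
   subspace of an ambient vector space V, and its norm nrm. *)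
Section mosco.
Context {R : realType} {V : lmodType R[i]}.
Variables (H : set V) (nrm : V -> R).

Definition bounded_functional (l : V -> R[i]) : Prop :=
  (forall (c : R[i]) u v, H u -> H v -> l (c *: u + v) = c * l u + l v) /\
  exists C : R, forall u, H u -> normc (l u) <= C * nrm u.

Definition weak_cvg (w_ : nat -> V) (w : V) : Prop :=
  forall l, bounded_functional l ->
    normc (l (w_ k) - l w) @[k --> \oo] --> (0 : R).

Definition mosco_cvg (W_ : nat -> set V) (W : set V) : Prop :=
  (forall w, W w -> exists w_ : nat -> V,
     (forall j, W_ j (w_ j)) /\ nrm (w_ j - w) @[j --> \oo] --> (0 : R)) /\
  (forall (j_ : nat -> nat) (w_ : nat -> V) (w : V),
     {homo j_ : k l / (k < l)%N} -> (forall k, W_ (j_ k) (w_ k)) ->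
     H w -> weak_cvg w_ w -> W w).

End mosco.

Definition bvp_cvg {R : realType} {m : nat}
    (Gamma_ : nat -> set 'rV[R]_m) (Gamma : set 'rV[R]_m) : Prop :=
  mosco_cvg (Hs (- 2^-1)) (Hs_norm (- 2^-1))
    (fun j => Hs_in (- 2^-1) (Gamma_ j)) (Hs_in (- 2^-1) Gamma).

Section iterated_function_system.
Context {R : realType} {m nu : nat}.

Definition contraction_map (f : 'rV[R]_m -> 'rV[R]_m) : Prop :=
  exists c : R, [/\ 0 < c, c < 1 &
    forall x y, enorm (f x - f y) <= c * enorm (x - y)].

Definition ifs_image (s : 'I_nu -> 'rV[R]_m -> 'rV[R]_m) (U : set 'rV[R]_m) :
  set 'rV[R]_m := \bigcup_(k in [set: 'I_nu]) (s k @` U).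

Definition is_attractor (s : 'I_nu -> 'rV[R]_m -> 'rV[R]_m)
    (Gamma : set 'rV[R]_m) : Prop :=
  [/\ Gamma !=set0, compact Gamma, Gamma = ifs_image s Gamma &
      forall K, K !=set0 -> compact K -> K = ifs_image s K -> K = Gamma].

End iterated_function_system.

(* Main.v *)
(** Since [Gamma_0] contains its image, the [Gamma_j] decrease to a non-empty
    compact set which is again a fixed point of the iterated function system, so
    [Gamma] is the intersection of the [Gamma_j] by uniqueness of the attractor.
    Hence the spaces [H_Gamma_j] decrease and all contain [H_Gamma], and constant
    sequences give the first half of Mosco convergence. For the second half, let
    [phi] be a test function. By Fourier inversion [phi] is the Fourier transform
    of a Schwartz function, so by Cauchy-Schwarz the evaluation [u |-> u phi] is
    bounded on [H^(-1/2)] and commutes with weak limits. If [phi] is supported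
    away from [Gamma_J], a partition of unity gives [w_k phi = 0] for large [k],
    hence [w phi = 0]: the weak limit [w] vanishes off every [Gamma_J].

    The Fourier analysis is carried out in real terms, with the transforms
    [xi |-> \int cos (xi . y + th) g y dy] of test functions [g]: the phase [th]
    stands for the choice between real and imaginary parts, and differentiation
    in [xi] or integration by parts shift it by [pi / 2]. *)

Require Import Defs.
From mathcomp Require Import all_boot all_order all_algebra.
From mathcomp Require Import complex.
From mathcomp Require Import all_classical all_reals all_analysis.
From mathcomp Require Import measurable_realfun.
From mathcomp Require Import ring lra.
Set Implicit Arguments.
Unset Strict Implicit.
Unset Printing Implicit Defensive.
Import Order.TTheory GRing.Theory Num.Theory.
Import numFieldNormedType.Exports.
Import ComplexField.Normc.
Local Open Scope classical_set_scope.
Local Open Scope complex_scope.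
Local Open Scope ring_scope.

(** * Integration on row vectors *)

(** The bulk is Fourier inversion, for a Lebesgue measure defined by iterated products. It is proved
    for test functions, whose transforms decay by integration by parts, and by induction on the
    dimension. On the line the outer integral is regularised by [exp (- e |xi|)]: its transform is
    rational with an arctangent as primitive, so every limit is elementary and no Gaussian integral
    occurs. Integrands are dominated by [weight], a product over the coordinates that factors along
    [rV_cons]. Constant sequences hide a second difficulty: the norm of [w - w] is computed from a
    chosen density of the zero distribution, so its vanishing is a uniqueness statement for
    densities. That statement needs smooth approximations of indicators of boxes, and the partition
    of unity needs cut-offs; both are built from [exp (- 1 / t)]. On the geometric side, the
    delicate half of the fixed-point equation is that each point of the intersection has a preimage
    in the intersection; this is a second use of compactness. *)

Section integration_tools.
Context {R : realType} {d} {T : measurableType d}.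
Context (mu : {measure set T -> \bar R}).
Implicit Types f g : T -> R.

Lemma dominated_integrable f g : measurable_fun setT f ->
  mu.-integrable setT (EFin \o g) -> (forall x, `|f x| <= g x) ->
  mu.-integrable setT (EFin \o f).
Proof.
move=> mf ig fg; apply: le_integrable ig => //; first exact/measurable_EFinP.
by move=> x _ /=; rewrite lee_fin (le_trans (fg x))// ler_norm.
Qed.

Lemma le_norm_Rintegral f g : measurable_fun setT f ->
  mu.-integrable setT (EFin \o g) -> (forall x, `|f x| <= g x) ->
  `|\int[mu]_x f x| <= \int[mu]_x g x.
Proof.
move=> mf ig fg; have iF := dominated_integrable mf ig fg.
apply: (le_trans (le_normr_Rintegral _ iF)) => //.
apply: le_Rintegral => //.
exact: integrable_norm.
Qed.

Lemma RintegralZ (r : R) f : mu.-integrable setT (EFin \o f) ->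
  \int[mu]_x (r * f x) = r * \int[mu]_x f x.
Proof. by move=> iF; rewrite RintegralZl. Qed.

Lemma integrableZ (r : R) f : mu.-integrable setT (EFin \o f) ->
  mu.-integrable setT (EFin \o (fun x => r * f x)).
Proof. by move=> iF; have := integrableZl measurableT r iF. Qed.

Lemma integrable_add f g : mu.-integrable setT (EFin \o f) ->
  mu.-integrable setT (EFin \o g) ->
  mu.-integrable setT (EFin \o (fun x => f x + g x)).
Proof. by move=> iF ig; have := integrableD measurableT iF ig. Qed.

Lemma integrable_sub f g : mu.-integrable setT (EFin \o f) ->
  mu.-integrable setT (EFin \o g) ->
  mu.-integrable setT (EFin \o (fun x => f x - g x)).
Proof. by move=> iF ig; have := integrableB measurableT iF ig. Qed.

Lemma integrable_measurable f : mu.-integrable setT (EFin \o f) -> measurable_fun setT f.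
Proof. by move=> /measurable_int/measurable_EFinP. Qed.

End integration_tools.

Section rV_measure.
Context {R : realType}.
Local Notation mu := (@lebesgue_measure R).
Local Notation leb := (@lebesgue_rV R).

Lemma rV_cons0 m (a : R) (v : 'rV[R]_m) : rV_cons (a, v) 0 ord0 = a.
Proof. by rewrite mxE unlift_none. Qed.

Lemma rV_consS m (a : R) (v : 'rV[R]_m) j : rV_cons (a, v) 0 (lift ord0 j) = v 0 j.
Proof. by rewrite mxE liftK. Qed.

Lemma rV_unconsK m : cancel (@rV_uncons R m) (@rV_cons R m).
Proof.
move=> x; apply/rowP => i; case: (unliftP ord0 i) => [j ->|->].
  by rewrite /rV_uncons rV_consS mxE.
by rewrite /rV_uncons rV_cons0.
Qed.

Lemma rV_ball m (x y : 'rV[R]_m) e : 0 < e ->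
  (forall j, `|x 0 j - y 0 j| < e) -> ball x e y.
Proof. by move=> e0 xy; split => // i j; rewrite ord1; exact: xy. Qed.

(** An open set is the union of the sup-norm cubes with rational centre and radius [1 / (n + 1)]
    that it contains. There are countably many of them, and each is a finite intersection of
    coordinate preimages. *)
Lemma measurable_rV_open m (A : set 'rV[R]_m) : open A -> measurable A.
Proof.
move=> oA.
pose B (p : 'rV[rat]_m * nat) : set 'rV[R]_m :=
  [set y | forall j, `|ratr (p.1 0 j) - y 0 j| < p.2.+1%:R^-1].
have mB p : measurable (B p).
  rewrite (_ : B p = \bigcap_(j in [set: 'I_m])
      (rV_coord j @^-1` ball (ratr (p.1 0 j) : R) p.2.+1%:R^-1)).
    apply: fin_bigcap_measurable; first exact: finite_finset.
    move=> j _; rewrite -[X in measurable X]setTI.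
    by apply: measurable_rV_coord => //; exact: measurable_ball.
  by apply/seteqP; split => [y By j _|y By j]; [exact: By|exact: (By j)].
rewrite (_ : A = \bigcup_(p in [set: 'rV[rat]_m * nat])
    if `[< B p `<=` A >] then B p else set0); last first.
  apply/seteqP; split => [x Ax|x [p _]]; last by case: asboolP => // pA Bx; exact: pA.
  have /nbhs_ballP[e /= e0 eA] : nbhs x A by exact: open_nbhs_nbhs.
  have [n _ ne] := near_infty_natSinv_lt (PosNum (divr_gt0 e0 (@ltr0n R 2))).
  have {}ne : n.+1%:R^-1 < e / 2 by exact: ne (leqnn n).
  have n0 : (0 : R) < n.+1%:R^-1 by rewrite invr_gt0.
  have /choice[q qP] (j : 'I_m) : exists q : rat,
      ratr q \in `](x 0 j), (x 0 j + n.+1%:R^-1)[.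
    by apply: rat_in_itvoo; rewrite ltrDl.
  have Bx : B (\row_j q j, n) x.
    move=> j /=; rewrite mxE; have := qP j; rewrite in_itv/= => /andP[q1 q2].
    by rewrite gtr0_norm ?subr_gt0// ltrBlDl.
  exists (\row_j q j, n) => //; case: asboolP => // -[] y By; apply: eA.
  apply: rV_ball => // j; have := Bx j; have := By j => /=.
  set a := ratr _; move=> ay ax.
  rewrite (_ : _ - _ = (a - y 0 j) - (a - x 0 j)); last by ring.
  rewrite (splitr e) (le_lt_trans (ler_normB _ _))//.
  by apply: ltrD; [exact: lt_trans ay ne|exact: lt_trans ax ne].
apply: countable_bigcupT_measurable => [|p]; last by case: ifP.
exact: countableP.
Qed.

Lemma measurable_rV_continuous m (f : 'rV[R]_m -> R) : continuous f -> measurable_fun setT f.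
Proof.
move=> cf; apply: (measurability _ (RGenOpens.measurableE R)).
move=> _ [_ [a [b ->]] <-]; rewrite setTI.
by apply: measurable_rV_open; move/continuousP : cf; apply; exact: interval_open.
Qed.

(** A universal integrable majorant. The product form lets its integral factor along [rV_cons],
    which a power of [enorm] would not. *)
Definition weight m (x : 'rV[R]_m) : R := \prod_(i < m) (1 + x 0 i ^+ 2)^-1.

Lemma weight_gt0 m (x : 'rV[R]_m) : 0 < weight x.
Proof. by apply: prodr_gt0 => i _; rewrite invr_gt0 ltr_wpDr// sqr_ge0. Qed.

Lemma weight_cons m a (v : 'rV[R]_m) : weight (rV_cons (a, v)) = (1 + a ^+ 2)^-1 * weight v.
Proof.
rewrite /weight big_ord_recl rV_cons0; congr *%R.
by apply: eq_bigr => i _; rewrite rV_consS.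
Qed.

Lemma continuous_inv1Dsqr : continuous (fun x : R => (1 + x ^+ 2)^-1).
Proof. exact: continuous_oneDsqrV. Qed.

Lemma measurable_inv1Dsqr : measurable_fun setT (fun x : R => (1 + x ^+ 2)^-1).
Proof. by apply: continuous_measurable_fun; exact: continuous_inv1Dsqr. Qed.

Lemma measurable_weight m : measurable_fun setT (@weight m).
Proof.
apply: measurable_prod => i _.
apply: (@measurableT_comp _ _ _ _ _ _ (fun x : R => (1 + x ^+ 2)^-1) _ (@rV_coord R m i)).
  exact: measurable_inv1Dsqr.
exact: measurable_rV_coord.
Qed.

Lemma ge0_integral_rV_cons m (f : 'rV[R]_m.+1 -> \bar R) : measurable_fun setT f ->
  (forall x, 0 <= f x)%E ->
  (\int[leb m.+1]_x f x = \int[mu]_a \int[leb m]_v f (rV_cons (a, v)))%E.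
Proof.
move=> mf f0; rewrite /= /lebesgue_rV_step ge0_integral_pushforward//; last first.
  exact: measurable_rV_cons.
rewrite preimage_setT fubini_tonelli1//; last by move=> x; exact: f0.
by apply: measurableT_comp => //; exact: measurable_rV_cons.
Qed.

Lemma integrable_rV_cons m (f : 'rV[R]_m.+1 -> R) : (leb m.+1).-integrable setT (EFin \o f) ->
  (mu \x leb m)%E.-integrable setT (EFin \o (f \o @rV_cons R m)).
Proof.
move=> /integrableP[mf].
have mc : measurable_fun setT ((EFin \o f) \o @rV_cons R m).
  by apply: measurableT_comp => //; exact: measurable_rV_cons.
rewrite ge0_integral_rV_cons//; last exact: measurableT_comp.
by move=> h; apply/integrable12ltyP.
Qed.

Lemma Rintegral_prod d1 d2 (T1 : measurableType d1) (T2 : measurableType d2)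
    (m1 : {sigma_finite_measure set T1 -> \bar R})
    (m2 : {sigma_finite_measure set T2 -> \bar R}) (f : T1 * T2 -> R) :
  (m1 \x m2)%E.-integrable setT (EFin \o f) ->
  \int[m1]_x \int[m2]_y f (x, y) = \int[(m1 \x m2)%E]_z f z.
Proof.
move=> iF; rewrite /Rintegral -integral12_prod_meas1//; congr fine.
have iFF := integrable_fubini_F iF.
(* the inner integral is a.e. finite, so [fine] is harmless *)
apply: ae_eq_integral => //.
- apply/measurable_EFinP/measurableT_comp => //; exact: measurable_int iFF.
- exact: measurable_int iFF.
have := integrable_ae measurableT iFF.
apply: filterS => x h _; rewrite fineK//; exact: h.
Qed.

Lemma Rintegral_rV_cons m (f : 'rV[R]_m.+1 -> R) : (leb m.+1).-integrable setT (EFin \o f) ->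
  \int[leb m.+1]_x f x = \int[mu]_a \int[leb m]_v f (rV_cons (a, v)).
Proof.
move=> iF; have ip := integrable_rV_cons iF.
rewrite (Rintegral_prod ip) /Rintegral /= /lebesgue_rV_step integral_pushforward//.
- exact: measurable_rV_cons.
- exact: measurable_int iF.
Qed.

Lemma integral_inv1Dsqr : (\int[mu]_x ((1 + x ^+ 2)^-1)%:E = pi%:E)%E.
Proof.
rewrite ge0_symfun_integralT.
- rewrite (_ : [set x | 0 <= x] = `[0, +oo[%classic); last first.
    by apply/seteqP; split => x /=; rewrite in_itv/= andbT.
  have := @integral0y_oneDsqr R; rewrite /oneDsqr => ->.
  by rewrite -EFinM mulrC divfK.
- by move=> x; rewrite invr_ge0 addr_ge0// sqr_ge0.
- exact: continuous_inv1Dsqr.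
- by move=> x /=; rewrite sqrrN.
Qed.

Lemma integrable_inv1Dsqr : mu.-integrable setT (EFin \o (fun x => (1 + x ^+ 2)^-1)).
Proof.
apply/integrableP; split; first by apply/measurable_EFinP; exact: measurable_inv1Dsqr.
under eq_integral do rewrite /= ger0_norm ?invr_ge0 ?addr_ge0 ?sqr_ge0//.
by rewrite integral_inv1Dsqr ltry.
Qed.

Lemma integrable_weight m : (leb m).-integrable setT (EFin \o @weight m).
Proof.
have mw n : measurable_fun setT (EFin \o @weight n).
  by apply/measurable_EFinP; exact: measurable_weight.
have aw n x : `|(EFin \o @weight n) x|%E = (weight x)%:E.
  by rewrite /= ger0_norm// ltW// weight_gt0.
elim: m => [|m /integrableP[_ IH]]; apply/integrableP;
  (split; first exact: mw); under eq_integral do rewrite aw.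
  rewrite [leb 0]/= integral_dirac//; last exact: (mw 0%N).
  by rewrite diracE in_setT mul1e ltry.
rewrite ge0_integral_rV_cons//; last by move=> x; rewrite lee_fin ltW// weight_gt0.
have eqW (a : R) : (\int[leb m]_v (weight (rV_cons (a, v)))%:E =
    (1 + a ^+ 2)^-1%:E * \int[leb m]_v (weight v)%:E)%E.
  under eq_integral do rewrite weight_cons EFinM.
  rewrite ge0_integralZl//.
  - exact: (mw m).
  - by move=> x _; rewrite lee_fin ltW// weight_gt0.
  - by rewrite lee_fin invr_ge0 addr_ge0// sqr_ge0.
under eq_integral do rewrite eqW.
have w0 : (0 <= \int[leb m]_v (weight v)%:E)%E.
  by apply: integral_ge0 => x _; rewrite lee_fin ltW// weight_gt0.
have {}IH : (\int[leb m]_v (weight v)%:E < +oo)%E.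
  by apply: le_lt_trans IH; under [X in (_ <= X)%E]eq_integral do rewrite aw.
move: IH; rewrite -ge0_fin_numE// => wfin; rewrite -(fineK wfin).
rewrite ge0_integralZr//.
- by rewrite integral_inv1Dsqr -EFinM ltry.
- by apply/measurable_EFinP; exact: measurable_inv1Dsqr.
- by move=> x _; rewrite lee_fin invr_ge0 addr_ge0// sqr_ge0.
- by rewrite fineK.
Qed.

Lemma weight_integrable m (f : 'rV[R]_m -> R) M : measurable_fun setT f ->
  (forall x, `|f x| <= M * weight x) -> (leb m).-integrable setT (EFin \o f).
Proof.
move=> mf fM; apply: dominated_integrable fM => //; apply: integrableZ; exact: integrable_weight.
Qed.

End rV_measure.

(** * Smooth and test functions *)

Section smooth_functions.
Context {R : realType}.

(** Smoothness is cut off at a finite order, here and in [smooth], so that closure under products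
    and composition follows by induction on it. Order 0 already means differentiable everywhere. *)
Fixpoint smooth1 (n : nat) (g : R -> R) : Prop :=
  (forall x, derivable g x 1) /\ (if n is k.+1 then smooth1 k (derive1 g) else True).

Fixpoint smooth m (n : nat) (f : 'rV[R]_m -> R) : Prop :=
  (forall x, differentiable f x) /\
  (if n is k.+1 then forall i, smooth k (fun x => 'D_('e_i) f x) else True).

Lemma smoothS m n (f : 'rV[R]_m -> R) : smooth n.+1 f -> smooth n f.
Proof.
elim: n f => [|n IH] f [df sf]; split => // i; apply: IH; exact: sf.
Qed.

Lemma smooth_differentiable m n (f : 'rV[R]_m -> R) x : smooth n f -> differentiable f x.
Proof. by case: n => [|n] [df _]. Qed.

Lemma smooth_partial m n i (f : 'rV[R]_m -> R) : smooth n.+1 f ->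
  smooth n (fun x => 'D_('e_i) f x).
Proof. by move=> [_ sf]; exact: sf. Qed.

Lemma smooth_cst m n (c : R) : smooth n (fun _ : 'rV[R]_m => c).
Proof.
elim: n c => [|n IH] c; (split; first by move=> x; exact: differentiable_cst) => //.
move=> i.
rewrite (_ : 'D_('e_i) _ = (fun _ => 0)); first exact: IH.
by apply/funext => x; rewrite derive_cst.
Qed.

Lemma smooth_add m n (f g : 'rV[R]_m -> R) : smooth n f -> smooth n g ->
  smooth n (fun x => f x + g x).
Proof.
elim: n f g => [|n IH] f g [df sf] [dg sg];
  (split; first by move=> x; exact: differentiableD) => //.
move=> i.
rewrite (_ : (fun _ => _) = (fun x => 'D_('e_i) f x + 'D_('e_i) g x)); last first.
  by apply/funext => x; rewrite deriveD//; exact: diff_derivable.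
by apply: IH; [exact: sf|exact: sg].
Qed.

Lemma smooth_mul m n (f g : 'rV[R]_m -> R) : smooth n f -> smooth n g ->
  smooth n (fun x => f x * g x).
Proof.
elim: n f g => [|n IH] f g sf sg.
  by split => // x; apply: differentiableM; [exact: sf.1|exact: sg.1].
split => [x|i]; first by apply: differentiableM; [exact: sf.1|exact: sg.1].
rewrite (_ : (fun _ => _) =
    (fun x => f x * 'D_('e_i) g x + g x * 'D_('e_i) f x)); last first.
  apply/funext => x; rewrite deriveM//; apply: diff_derivable.
    exact: sf.1.
  exact: sg.1.
by apply: smooth_add; apply: IH; try exact: smooth_partial; exact: smoothS.
Qed.

Lemma smooth_opp m n (f : 'rV[R]_m -> R) : smooth n f -> smooth n (fun x => - f x).
Proof.
move=> sf; rewrite (_ : (fun _ => _) = (fun x => -1 * f x)).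
  by apply: smooth_mul => //; exact: smooth_cst.
by apply/funext => x; rewrite mulN1r.
Qed.

Lemma smooth_sub m n (f g : 'rV[R]_m -> R) : smooth n f -> smooth n g ->
  smooth n (fun x => f x - g x).
Proof. by move=> sf sg; apply: smooth_add => //; exact: smooth_opp. Qed.

Lemma smooth_prod m n (I : Type) (r : seq I) (f : I -> 'rV[R]_m -> R) :
  (forall i, smooth n (f i)) -> smooth n (fun x => \prod_(i <- r) f i x).
Proof.
move=> sf; elim: r => [|i r IH].
  rewrite (_ : (fun _ => _) = (fun _ => 1)); first exact: smooth_cst.
  by apply/funext => x; rewrite big_nil.
rewrite (_ : (fun _ => _) = (fun x => f i x * \prod_(j <- r) f j x)).
  exact: smooth_mul.
by apply/funext => x; rewrite big_cons.
Qed.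

(** A directional derivative only sees the restriction to a line. This carries derivatives over to
    ridge functions, slices and translates, between different spaces. *)
Lemma derive_line (U V : normedModType R) (F : U -> R) (f : V -> R) (x v : U) (y w : V) :
  (forall h : R, F (h *: v + x) = f (h *: w + y)) -> 'D_v F x = 'D_w f y.
Proof.
move=> Ff; rewrite /derive.
rewrite (_ : (fun h => h^-1 *: ((f \o shift y) (h *: w) - f y)) =
   (fun h => h^-1 *: ((F \o shift x) (h *: v) - F x)))//.
apply/funext => h /=.
by have := Ff 0; rewrite !scale0r !add0r Ff => ->.
Qed.

Lemma derivable_line (U V : normedModType R) (F : U -> R) (f : V -> R) (x v : U) (y w : V) :
  (forall h : R, F (h *: v + x) = f (h *: w + y)) -> derivable f y w -> derivable F x v.
Proof.
move=> Ff; rewrite /derivable.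
rewrite (_ : (fun h => h^-1 *: ((f \o shift y) (h *: w) - f y)) =
   (fun h => h^-1 *: ((F \o shift x) (h *: v) - F x)))//.
apply/funext => h /=.
by have := Ff 0; rewrite !scale0r !add0r Ff => ->.
Qed.

Lemma dotrD m (xi x y : 'rV[R]_m) : dotr xi (x + y) = dotr xi x + dotr xi y.
Proof. by rewrite /dotr -big_split; apply: eq_bigr => i _; rewrite mxE mulrDr. Qed.

Lemma dotrZ m (xi x : 'rV[R]_m) a : dotr xi (a *: x) = a * dotr xi x.
Proof. by rewrite /dotr mulr_sumr; apply: eq_bigr => i _; rewrite mxE mulrCA. Qed.

Lemma dotrC m (x y : 'rV[R]_m) : dotr x y = dotr y x.
Proof. by apply: eq_bigr => i _; rewrite mulrC. Qed.

Lemma dotr_e m (x : 'rV[R]_m) i : dotr x 'e_i = x 0 i.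
Proof.
rewrite /dotr (bigD1 i)//= mxE !eqxx mulr1 big1 ?addr0// => j ji.
by rewrite mxE eqxx (negbTE ji) mulr0.
Qed.

Lemma differentiable_dotr m (xi x : 'rV[R]_m) : differentiable (dotr xi) x.
Proof.
rewrite (_ : dotr xi = \sum_(i < m) (fun y : 'rV[R]_m => xi 0 i *: y 0 i)).
  apply: differentiable_sum => i; apply: differentiableZ; exact: differentiable_coord.
by apply/funext => y; rewrite fct_sumE.
Qed.

Lemma derive_dir1 (g : R -> R) (y w : R) : derivable g y 1 ->
  'D_w g y = w * derive1 g y.
Proof.
move=> /derivable1_diffP dg; rewrite derive1E !deriveE//.
by rewrite -{1}[w]mulr1 linearZ.
Qed.

Lemma derive_ridge m (g : R -> R) (xi x v : 'rV[R]_m) :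
  derivable g (dotr xi x) 1 ->
  'D_v (fun y => g (dotr xi y)) x = dotr xi v * derive1 g (dotr xi x).
Proof.
move=> dg; rewrite -derive_dir1//; apply: derive_line => h.
by rewrite dotrD dotrZ.
Qed.

Lemma smooth_ridge m n (g : R -> R) (xi : 'rV[R]_m) : smooth1 n g ->
  smooth n (fun y => g (dotr xi y)).
Proof.
have dR (f : R -> R) : (forall x, derivable f x 1) ->
    forall x, differentiable (fun y => f (dotr xi y)) x.
  move=> df x; apply: (@differentiable_comp _ _ _ _ (dotr xi) f).
    exact: differentiable_dotr.
  exact/derivable1_diffP.
elim: n g => [|n IH] g [dg sg]; (split; first exact: dR) => // i.
rewrite (_ : (fun _ => _) = (fun y => dotr xi 'e_i * derive1 g (dotr xi y))).
  apply: smooth_mul; [exact: smooth_cst|exact: IH].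
by apply/funext => y; rewrite derive_ridge.
Qed.

Lemma smooth1_id n : smooth1 n id.
Proof.
case: n => [|n]; (split; first by move=> x; exact: derivable_id) => //.
rewrite (_ : derive1 (id : R -> R) = (fun _ => 1)); last by apply/funext => x; rewrite derive1_id.
elim: n (1 : R) => [|n IH] c; (split; first by move=> x; exact: derivable_cst) => //.
by rewrite (_ : derive1 _ = (fun _ => 0)); [exact: IH|apply/funext => x; rewrite derive1_cst].
Qed.

Lemma smooth_coord m n (i : 'I_m) : smooth n (fun x : 'rV[R]_m => x 0 i).
Proof.
rewrite (_ : (fun _ => _) = (fun x => id (dotr 'e_i x))).
  by apply: (@smooth_ridge m n id); exact: smooth1_id.
by apply/funext => x; rewrite dotrC dotr_e.
Qed.

Lemma rV_cons_shift0 m (h t : R) (v : 'rV[R]_m) :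
  rV_cons (h *: (1 : R) + t, v) = h *: 'e_ord0 + rV_cons (t, v).
Proof.
apply/rowP => i; case: (unliftP ord0 i) => [j ->|->].
  by rewrite mxE liftK/= !mxE liftK /= mulr0 add0r.
by rewrite mxE unlift_none /= !mxE unlift_none/=.
Qed.

Lemma rV_cons_shift m (a h : R) j (v : 'rV[R]_m) :
  rV_cons (a, h *: 'e_j + v) = h *: 'e_(lift ord0 j) + rV_cons (a, v).
Proof.
apply/rowP => i; case: (unliftP ord0 i) => [k ->|->].
  by rewrite mxE liftK/= !mxE liftK /= (inj_eq (@lift_inj _ ord0)).
by rewrite mxE unlift_none /= !mxE unlift_none/= mulr0 add0r.
Qed.

Lemma differentiable_rV_cons m (a : R) (v : 'rV[R]_m) :
  differentiable (fun v => rV_cons (a, v) : 'rV[R]_m.+1) v.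
Proof.
rewrite (_ : (fun _ => _) = (cst (rV_cons (a, 0)) : 'rV[R]_m -> 'rV[R]_m.+1) +
    \sum_(j < m) (fun v : 'rV[R]_m => v 0 j *: 'e_(lift ord0 j) : 'rV[R]_m.+1)).
  apply: differentiableD; first exact: differentiable_cst.
  apply: differentiable_sum => j.
  apply: differentiableZl; exact: differentiable_coord.
apply/funext => y; rewrite !fctE fct_sumE; apply/rowP => i.
rewrite [in RHS]mxE summxE.
case: (unliftP ord0 i) => [k ->|->].
  rewrite !mxE liftK/= mxE add0r (bigD1 k)//= !mxE !eqxx mulr1 big1 ?addr0// => j jk.
  by rewrite !mxE (inj_eq (@lift_inj _ ord0)) eq_sym (negbTE jk) mulr0.
by rewrite !mxE unlift_none /= big1 ?addr0// => j _; rewrite !mxE mulr0.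
Qed.

Lemma derive_slice m (a : R) j (f : 'rV[R]_m.+1 -> R) (v : 'rV[R]_m) :
  'D_('e_j) (fun v => f (rV_cons (a, v))) v = 'D_('e_(lift ord0 j)) f (rV_cons (a, v)).
Proof. by apply: derive_line => h; rewrite rV_cons_shift. Qed.

Lemma smooth_slice m n (a : R) (f : 'rV[R]_m.+1 -> R) : smooth n f ->
  smooth n (fun v => f (rV_cons (a, v))).
Proof.
have dR (g : 'rV[R]_m.+1 -> R) : (forall x, differentiable g x) ->
    forall v, differentiable (fun v => g (rV_cons (a, v))) v.
  move=> dg v; apply: (@differentiable_comp _ _ _ _ (fun v => rV_cons (a, v) : 'rV_m.+1) g) => //.
  exact: differentiable_rV_cons.
elim: n f => [|n IH] f [df sf]; (split; first exact: dR) => // i.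
rewrite (_ : (fun _ => _) = (fun v => 'D_('e_(lift ord0 i)) f (rV_cons (a, v)))).
  by apply: (IH (fun y => 'D_('e_(lift ord0 i)) f y)); exact: sf.
by apply/funext => v; rewrite derive_slice.
Qed.

Lemma derive1_slice0 m (f : 'rV[R]_m.+1 -> R) (t : R) (v : 'rV[R]_m) :
  derive1 (fun t => f (rV_cons (t, v))) t = 'D_('e_ord0) f (rV_cons (t, v)).
Proof. by rewrite derive1E; apply: derive_line => h; rewrite rV_cons_shift0. Qed.

Lemma derivable_slice0 m (f : 'rV[R]_m.+1 -> R) (t : R) (v : 'rV[R]_m) :
  (forall x, differentiable f x) -> derivable (fun t => f (rV_cons (t, v))) t 1.
Proof.
move=> df; apply: (@derivable_line _ _ _ f _ _ (rV_cons (t, v)) 'e_ord0).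
  by move=> h; rewrite rV_cons_shift0.
exact: diff_derivable.
Qed.

Lemma smooth_continuous m n (f : 'rV[R]_m -> R) : smooth n f -> continuous f.
Proof.
by move=> sf x; apply: differentiable_continuous; exact: smooth_differentiable sf.
Qed.

Lemma csmoothP m (f : 'rV[R]_m -> R[i]) : csmooth f <->
  forall n, smooth n (fun x => complex.Re (f x)) /\ smooth n (fun x => complex.Im (f x)).
Proof.
split => [sf n|].
  elim: n f sf => [|n IH] f sf; first by split; split => // x; case: (sf [::] x).
  (* [cpartials] nests by [foldr], so the derivative applied first to [f] is the last entry of the
     list. *)
  have sp i : csmooth (cpartial i f).
    by move=> a x; have := sf (rcons a i) x; rewrite /cpartials foldr_rcons.
  split; (split => [x|i]; first by case: (sf [::] x)); by case: (IH _ (sp i)).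
move=> sf a; elim/last_ind: a f sf => [|a i IH] f sf x.
  by case: (sf 0%N) => -[s1 _] [s2 _]; split.
rewrite /cpartials foldr_rcons; apply: IH => n.
by have [[_ s1] [_ s2]] := sf n.+1; split; [exact: s1|exact: s2].
Qed.

End smooth_functions.

(** * Flat functions and plateaus on the line *)

Section one_variable.
Context {R : realType}.

Lemma smooth1S n (g : R -> R) : smooth1 n.+1 g -> smooth1 n g.
Proof. by elim: n g => [|n IH] g [dg sg]; split => //; exact: IH. Qed.

Lemma smooth1_cst n (c : R) : smooth1 n (fun=> c).
Proof.
elim: n c => [|n IH] c; (split; first by move=> x; exact: derivable_cst) => //.
by rewrite (_ : derive1 _ = (fun _ => 0)); [exact: IH|apply/funext => x; rewrite derive1_cst].
Qed.

Lemma smooth1_add n (f g : R -> R) : smooth1 n f -> smooth1 n g ->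
  smooth1 n (fun x => f x + g x).
Proof.
elim: n f g => [|n IH] f g [df sf] [dg sg];
  (split; first by move=> x; exact: derivableD) => //.
rewrite (_ : derive1 _ = (fun x => derive1 f x + derive1 g x)); first exact: IH.
by apply/funext => x; rewrite !derive1E deriveD.
Qed.

Lemma smooth1_mul n (f g : R -> R) : smooth1 n f -> smooth1 n g ->
  smooth1 n (fun x => f x * g x).
Proof.
elim: n f g => [|n IH] f g sf sg.
  by split => // x; apply: derivableM; [exact: sf.1|exact: sg.1].
split => [x|]; first by apply: derivableM; [exact: sf.1|exact: sg.1].
rewrite (_ : derive1 _ = (fun x => f x * derive1 g x + g x * derive1 f x)).
  by apply: smooth1_add; apply: IH; try exact: smooth1S; [exact: sg.2|exact: sf.2].
by apply/funext => x; rewrite !derive1E deriveM//; [exact: sf.1|exact: sg.1].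
Qed.

Lemma smooth1_comp n (f g : R -> R) : smooth1 n f -> smooth1 n g ->
  smooth1 n (fun x => f (g x)).
Proof.
have dc (u v : R -> R) x : derivable u (v x) 1 -> derivable v x 1 ->
    derivable (fun x => u (v x)) x 1.
  move=> /derivable1_diffP du /derivable1_diffP dv; apply/derivable1_diffP.
  exact: (@differentiable_comp _ _ _ _ v u).
elim: n f g => [|n IH] f g sf sg.
  by split => // x; apply: dc; [exact: sf.1|exact: sg.1].
split => [x|]; first by apply: dc; [exact: sf.1|exact: sg.1].
rewrite (_ : derive1 _ = (fun x => derive1 f (g x) * derive1 g x)).
  apply: smooth1_mul; last exact: sg.2.
  by apply: IH; [exact: sf.2|exact: smooth1S].
by apply/funext => x; rewrite derive1_comp//; [exact: sg.1|exact: sf.1].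
Qed.

Lemma smooth1_affine n (a b : R) : smooth1 n (fun x => a * x + b).
Proof.
apply: smooth1_add; last exact: smooth1_cst.
by apply: smooth1_mul; [exact: smooth1_cst|exact: smooth1_id].
Qed.

(** Each monomial is absorbed by one term of the exponential series, [s ^ i / i! <= exp s]. *)
Lemma horner_expRN_bounded (p : {poly R}) :
  exists C : R, forall s, 0 <= s -> `|p.[s] * expR (- s)| <= C.
Proof.
exists (\sum_(i < size p) `|p`_i| * i`!%:R) => s s0.
rewrite horner_coef mulr_suml (le_trans (ler_norm_sum _ _ _))//.
apply: ler_sum => i _; rewrite -mulrA normrM ler_wpM2l//.
rewrite ger0_norm ?mulr_ge0 ?exprn_ge0 ?expR_ge0//.
rewrite expRN ler_pdivrMr ?expR_gt0//.
case: i => -[|i] _ /=; first by rewrite expr0 fact0 mul1r -{1}(expR0 R) ler_expR.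
rewrite mulrC -ler_pdivrMr ?ltr0n ?fact_gt0//.
by apply: le_trans (expR_ge1Dxn i s0); rewrite lerDr.
Qed.

(** Serves twice: for [flatp] at the origin, and, once the candidate differential has been
    subtracted, to differentiate [cosft] under the integral sign. *)
Lemma differentiable_quadratic (V : normedModType R) (g : V -> R) (x : V) (C : R) :
  (forall h, `|g (h + x) - g x| <= C * `|h| ^+ 2) ->
  differentiable g x /\ forall v, 'D_v g x = 0.
Proof.
move=> gC.
have C0 : 0 < `|C| + 1 by rewrite ltr_wpDl.
have gC' h : `|g (h + x) - g x| <= (`|C| + 1) * `|h| ^+ 2.
  apply: (le_trans (gC h)); rewrite ler_wpM2r ?exprn_ge0//.
  by rewrite (le_trans (ler_norm _))// lerDl.
have go : g \o shift x = cst (g x) + (\0 : V -> R) +o_ (0 : V) id.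
  apply/eqaddoP => _/posnumP[e]; near=> h.
  rewrite !fctE addr0 /=; apply: (le_trans (gC' h)).
  rewrite expr2 mulrA ler_wpM2r//.
  rewrite mulrC -(ler_pdivlMr _ _ C0).
  near: h; apply/nbhs_ballP; exists (e%:num / (`|C| + 1)) => /=.
    by rewrite divr_gt0.
  by move=> h; rewrite -ball_normE/= sub0r normrN => /ltW.
have d0 : 'd g x = \0 :> (V -> R).
  by apply: diff_unique => // ?; exact: cvg_cst.
have dg : differentiable g x.
  apply/diff_locallyP; rewrite d0; split => // ?; exact: cvg_cst.
by split => // v; rewrite deriveE// d0.
Unshelve. all: by end_near. Qed.

(** The functions [p(1/t) exp(-1/t)], extended by 0, form a class stable under differentiation: [p]
    becomes [X^2 (p - p')]. Their smoothness thus reduces to a single derivative. *)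
Definition flatp (p : {poly R}) (t : R) : R :=
  if 0 < t then p.[t^-1] * expR (- t^-1) else 0.

Lemma is_derive_flatp (p : {poly R}) (t : R) :
  is_derive t 1 (flatp p) (flatp ('X ^+ 2 * (p - p^`())) t).
Proof.
have [t0|t0|->] := ltgtP t 0.
- rewrite {2}/flatp ltNge (ltW t0)/=.
  apply: (@near_eq_is_derive _ _ _ (cst 0)).
    near=> s; rewrite /flatp ltNge (_ : s <= 0)//.
    by apply: ltW; near: s; exact: lt_nbhsl.
- rewrite {2}/flatp t0.
  have dV : is_derive t 1 (fun s : R => s^-1) (- t ^- 2).
    have := @is_deriveV R id t 1 1 (lt0r_neq0 t0) (is_derive_id _ _).
    by rewrite scaler1.
  have dp := is_derive1_comp (is_derive_poly p t^-1) dV.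
  have dN : is_derive t 1 (fun s : R => - s^-1) (t ^- 2).
    by have := is_deriveN dV; rewrite opprK.
  have dE := @is_derive1_comp R expR (fun s => - s^-1) t _ _ (is_derive_expR (- t^-1)) dN.
  have D : is_derive t 1 (fun s : R => p.[s^-1] * expR (- s^-1))
      (('X^2 * (p - p^`())).[t^-1] * expR (- t^-1)).
    have [D1 D2] := is_deriveM dp dE; apply: DeriveDef; first exact: D1.
    rewrite [LHS]D2 /=.
    rewrite hornerM hornerD hornerN hornerXn exprVn /GRing.scale/=.
    by ring.
  apply: near_eq_is_derive D.
  near=> s; rewrite /flatp (_ : 0 < s)//.
  by near: s; exact: lt_nbhsr.
(* With the extra factor [X^2], the bound at [s = 1/h] says that [flatp p h] is at most [C h^2], so
   the derivative at 0 exists and vanishes. *)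
- have [C CP] := horner_expRN_bounded ('X ^+ 2 * p).
  have : forall h : R, `|flatp p (h + 0) - flatp p 0| <= C * `|h| ^+ 2.
    move=> h; rewrite addr0 /flatp ltxx subr0.
    have C0 : 0 <= C by apply: le_trans (CP 0 (lexx _)).
    case: ifPn => h0; last by rewrite normr0 mulr_ge0// exprn_ge0.
    rewrite (gtr0_norm h0) -ler_pdivrMr ?exprn_gt0//.
    have hi : 0 <= h^-1 by rewrite invr_ge0 ltW.
    apply: le_trans (CP _ hi); rewrite hornerM !hornerE/=.
    rewrite -mulrA [X in _ <= X]normrM (ger0_norm (exprn_ge0 _ _))// mulrC.
    by rewrite exprVn.
  move=> /differentiable_quadratic[df d0].
  rewrite {2}/flatp ltxx; apply: DeriveDef; [exact: diff_derivable|exact: d0].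
Unshelve. all: by end_near. Qed.

Lemma smooth1_flatp n (p : {poly R}) : smooth1 n (flatp p).
Proof.
elim: n p => [|n IH] p; (split; first by move=> t; have [] := is_derive_flatp p t) => //.
rewrite (_ : derive1 _ = flatp ('X ^+ 2 * (p - p^`()))); first exact: IH.
by apply/funext => t; rewrite derive1E; have [_ ->] := is_derive_flatp p t.
Qed.

Definition flat (t : R) : R := if 0 < t then expR (- t^-1) else 0.

Lemma smooth1_flat n : smooth1 n flat.
Proof.
rewrite (_ : flat = flatp 1); first exact: smooth1_flatp.
by apply/funext => t; rewrite /flat /flatp hornerE mul1r.
Qed.

Lemma flat_le0 t : t <= 0 -> flat t = 0.
Proof. by rewrite /flat leNgt => /negbTE ->. Qed.

Lemma flat_gt0 t : 0 < t -> 0 < flat t.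
Proof. by rewrite /flat => ->; rewrite expR_gt0. Qed.

Lemma flat_ge0 t : 0 <= flat t.
Proof. by rewrite /flat; case: ifP => // _; rewrite expR_ge0. Qed.

Lemma flat_le1 t : flat t <= 1.
Proof.
rewrite /flat; case: ifP => // t0.
by rewrite -(expR0 R) ler_expR oppr_le0 invr_ge0 ltW.
Qed.

Lemma flat_homo s t : s <= t -> flat s <= flat t.
Proof.
move=> st; rewrite /flat; case: ifPn => s0; last by case: ifP; rewrite ?expR_ge0.
have t0 := lt_le_trans s0 st.
by rewrite t0 ler_expR lerN2 lef_pV2.
Qed.

Lemma cvg_flat t : 0 < t -> flat (k.+1%:R * t) @[k --> \oo] --> (1 : R).
Proof.
move=> t0.
rewrite (_ : (fun k => _) = (fun k : nat => expR (- (t^-1 * k.+1%:R^-1)))); last first.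
  by apply/funext => k; rewrite /flat mulr_gt0// invfM mulrC.
have : - (t^-1 * k.+1%:R^-1) @[k --> \oo] --> - (t^-1 * 0).
  by apply: cvgN; apply: cvgMr; exact: (@cvg_harmonic R).
rewrite mulr0 oppr0 => h.
rewrite -[X in _ --> X](expR0 R).
by apply: continuous_cvg => //; exact: continuous_expR.
Qed.

(** Composing [flat] with itself gives a smooth step from 0 to exactly 1 while dividing only by a
    constant: the argument of the outer [flat] is nonpositive for [t <= 0] and equals [flat 1] for
    [t >= 1]. *)
Definition plateau (t : R) : R := flat (flat 1 - flat (1 - t)) / flat (flat 1).

Lemma smooth1_plateau n : smooth1 n plateau.
Proof.
apply: smooth1_mul; last exact: smooth1_cst.
apply: smooth1_comp; first exact: smooth1_flat.
rewrite (_ : (fun _ => _) = (fun t => (-1 * flat (-1 * t + 1) + flat 1))).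
  apply: (@smooth1_comp n (fun x => -1 * x + flat 1) (fun t => flat (-1 * t + 1))).
    exact: smooth1_affine.
  by apply: smooth1_comp; [exact: smooth1_flat|exact: smooth1_affine].
by apply/funext => t; rewrite !mulN1r addrC [1 - t]addrC.
Qed.

Lemma plateau_ge1 t : 1 <= t -> plateau t = 1.
Proof.
move=> t1; rewrite /plateau (@flat_le0 (1 - t)) ?subr_le0// subr0 divff//.
by rewrite gt_eqF// !flat_gt0.
Qed.

Lemma plateau_le0 t : t <= 0 -> plateau t = 0.
Proof.
move=> t0; rewrite /plateau flat_le0 ?mul0r// subr_le0 flat_homo//.
by rewrite lerBrDr gerDl.
Qed.

End one_variable.

(** * Test functions and the integral of their derivatives *)

Section test_functions.
Context {R : realType}.
Local Notation mu := (@lebesgue_measure R).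
Local Notation leb := (@lebesgue_rV R).

Definition bounded_support m (g : 'rV[R]_m -> R) : Prop :=
  exists L : R, forall (x : 'rV[R]_m) i, L < `|x 0 i| -> g x = 0.

Definition test_function m (g : 'rV[R]_m -> R) : Prop :=
  (forall n, smooth n g) /\ bounded_support g.

Lemma test_mul m (f g : 'rV[R]_m -> R) : (forall n, smooth n f) ->
  test_function g -> test_function (fun x => f x * g x).
Proof.
move=> sf [sg [L gL]]; split => [n|]; first exact: smooth_mul.
by exists L => x i xL; rewrite (gL _ _ xL) mulr0.
Qed.

Lemma test_opp m (f : 'rV[R]_m -> R) : test_function f -> test_function (fun x => - f x).
Proof.
move=> [sf [K fK]]; split => [n|]; first exact: smooth_opp.
by exists K => x i xK; rewrite (fK _ _ xK) oppr0.
Qed.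

Lemma test_partial m i (f : 'rV[R]_m -> R) : test_function f ->
  test_function (fun x => 'D_('e_i) f x).
Proof.
move=> [sf [L fL]]; split => [n|]; first exact: smooth_partial.
exists L => x j xL; rewrite (_ : 'D_('e_i) f x = 'D_('e_i) (cst 0 : 'rV[R]_m -> R) x).
  by rewrite derive_cst.
apply: near_eq_derive; near=> y; apply: (fL y j).
near: y.
have : (fun y : 'rV[R]_m => `|y 0 j|) y @[y --> x] --> `|x 0 j|.
  have c : continuous (fun y : 'rV[R]_m => y 0 j) := smooth_continuous (smooth_coord 0%N j).
  exact: (cvg_norm (c x)).
by move=> /cvgr_gt; apply.
Unshelve. all: by end_near. Qed.

Lemma test_bounded m (g : 'rV[R]_m -> R) : continuous g -> bounded_support g ->
  exists M, forall x, `|g x| <= M.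
Proof.
move=> cg [L gL].
have cK : compact [set v : 'rV[R]_m | forall i, `[- L, L]%classic (v 0 i)].
  by apply: (@rV_compact _ _ (fun=> `[- L, L]%classic)) => i; exact: segment_compact.
have /compact_bounded[M [Mr MP]] : compact (g @` [set v : 'rV[R]_m | forall i, `[- L, L]%classic (v 0 i)]).
  apply: continuous_compact => //; exact: continuous_subspaceT.
exists (`|M| + 1) => x.
have [xK|] := pselect (forall i, `[- L, L]%classic (x 0 i)).
  apply: MP; last by exists x.
  by rewrite (le_lt_trans (ler_norm _))// ltrDl.
move=> /existsNP[k]; rewrite /= in_itv/= -ler_norml => /negP.
by rewrite -ltNge => /gL ->; rewrite normr0 addr_ge0.
Qed.

Lemma smooth_sqr_coord m n i : smooth n (fun x : 'rV[R]_m => 1 + x 0 i ^+ 2).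
Proof.
apply: smooth_add; first exact: smooth_cst.
by apply: smooth_mul; exact: smooth_coord.
Qed.

(** Multiplying [g] by the polynomial [1 / weight] gives another test function, which is bounded. *)
Lemma test_weight m (g : 'rV[R]_m -> R) : test_function g ->
  exists M, forall x, `|g x| <= M * weight x.
Proof.
move=> tg.
have [sf sf2] := @test_mul _ (fun x => \prod_(i < m) (1 + x 0 i ^+ 2)) _
  (fun n => smooth_prod _ (fun i => smooth_sqr_coord n i)) tg.
have [M MP] := test_bounded (smooth_continuous (sf 0%N)) sf2.
exists M => x; have := MP x.
rewrite /weight prodfV normrM ger0_norm; last first.
  by apply: prodr_ge0 => i _; rewrite addr_ge0// sqr_ge0.
rewrite ler_pdivlMr 1?mulrC//.
by apply: prodr_gt0 => i _; rewrite ltr_wpDr// sqr_ge0.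
Qed.

Lemma test_measurable m (g : 'rV[R]_m -> R) : test_function g -> measurable_fun setT g.
Proof.
by move=> [sg _]; apply: measurable_rV_continuous; exact: smooth_continuous (sg 0%N).
Qed.

Lemma test_integrable m (g : 'rV[R]_m -> R) : test_function g ->
  (leb m).-integrable setT (EFin \o g).
Proof.
move=> tg; have [M MP] := test_weight tg.
by apply: weight_integrable MP; exact: test_measurable.
Qed.

Lemma test_slice m (a : R) (g : 'rV[R]_m.+1 -> R) : test_function g ->
  test_function (fun v => g (rV_cons (a, v))).
Proof.
move=> [sg [L gL]]; split => [n|]; first exact: smooth_slice.
by exists L => v i vL; apply: (gL _ (lift ord0 i)); rewrite rV_consS.
Qed.

Lemma Rintegral_prod2 d1 d2 (T1 : measurableType d1) (T2 : measurableType d2)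
    (m1 : {sigma_finite_measure set T1 -> \bar R})
    (m2 : {sigma_finite_measure set T2 -> \bar R}) (f : T1 * T2 -> R) :
  (m1 \x m2)%E.-integrable setT (EFin \o f) ->
  \int[m2]_y \int[m1]_x f (x, y) = \int[(m1 \x m2)%E]_z f z.
Proof.
move=> iF; pose h z := f (z.2, z.1).
have ih : (m2 \x m1)%E.-integrable setT (EFin \o h).
  have mf := measurable_int _ iF.
  apply/integrable12ltyP; first exact: (measurableT_comp mf (@measurable_swap _ _ _ _)).
  by move/integrable21ltyP : iF; apply.
rewrite (Rintegral_prod ih) /Rintegral -integral12_prod_meas1//.
by rewrite -[in RHS]integral21_prod_meas1.
Qed.

Lemma Rintegral_derive1 (g : R -> R) (L : R) : (forall t, derivable g t 1) ->
  continuous (derive1 g) -> (forall t, L < `|t| -> g t = 0) ->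
  \int[mu]_t derive1 g t = 0.
Proof.
move=> dg cg gL; pose K := `|L| + 1.
have K0 : 0 < K by rewrite ltr_wpDl.
have LK : L < K by rewrite (le_lt_trans (ler_norm _))// ltrDl.
have dL t : L < `|t| -> derive1 g t = 0.
  move=> tL; rewrite derive1E.
  suff -> : 'D_1 g t = 'D_1 (cst 0 : R -> R) t by rewrite derive_cst.
  apply: near_eq_derive; near=> y; apply: gL; near: y.
  have : `|y| @[y --> t] --> `|t| by apply: cvg_norm.
  by move=> /cvgr_gt; apply.
rewrite (_ : \int[mu]_t _ = \int[mu]_(t in `[- K, K]) derive1 g t); last first.
  rewrite [RHS]Rintegral_mkcond; apply: eq_Rintegral => t _.
  rewrite patchE; case: ifPn => //; rewrite notin_setE/= in_itv/= -ler_norml.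
  by move=> /negP; rewrite -ltNge => tK; apply: dL; exact: lt_trans tK.
rewrite /Rintegral (@continuous_FTC2 _ _ g).
- have gK : g K = 0 by apply: gL; rewrite ger0_norm// ltW.
  have gNK : g (- K) = 0 by apply: gL; rewrite normrN ger0_norm// ltW.
  by rewrite gK gNK -EFinB subrr.
- by rewrite gtrN.
- exact: continuous_subspaceT.
- have gc t : {for t, continuous g}.
    by apply: differentiable_continuous; exact/derivable1_diffP.
  split => [t _||]; first exact: dg.
  + by apply: cvg_at_right_filter; exact: gc.
  + by apply: cvg_at_left_filter; exact: gc.
- by [].
Unshelve. all: by end_near. Qed.

(** Induction on the dimension. A direction other than the first one lives in the slices; for the
    first one, Fubini makes its variable the inner one, where the fundamental theorem of calculus
    applies. *)
Lemma Rintegral_partial m i (g : 'rV[R]_m -> R) : test_function g ->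
  \int[leb m]_x 'D_('e_i) g x = 0.
Proof.
elim: m i g => [|m IH] i g tg; first by case: i.
have iD := test_integrable (test_partial i tg).
case: (unliftP ord0 i) => [j|] ij.
  rewrite Rintegral_rV_cons// ij.
  under eq_Rintegral => a _.
    under eq_Rintegral do rewrite -derive_slice.
    rewrite (IH j (fun v => g (rV_cons (a, v))))//; last exact: test_slice.
    over.
  by rewrite Rintegral_cst// mul0r.
rewrite Rintegral_rV_cons//.
have ip := integrable_rV_cons iD.
rewrite (Rintegral_prod ip) -(Rintegral_prod2 ip)/= ij.
have [sg [L gL]] := tg.
under eq_Rintegral => v _.
  under eq_Rintegral do rewrite -derive1_slice0.
  rewrite (@Rintegral_derive1 _ L).
  - over.
  - by move=> t; apply: derivable_slice0 => x; exact: (sg 0%N).1.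
  - rewrite (_ : derive1 _ = fun t => 'D_('e_ord0) g (rV_cons (t, v))); last first.
      by apply/funext => t; rewrite derive1_slice0.
    move=> t; apply: differentiable_continuous; apply/derivable1_diffP.
    apply: (@derivable_slice0 _ _ (fun x => 'D_('e_ord0) g x)) => x.
    exact: ((sg 1%N).2 ord0).1.
  - by move=> t tL; apply: (gL _ ord0); rewrite rV_cons0.
by rewrite Rintegral_cst// mul0r.
Qed.

End test_functions.

(** * Cosine transforms and Fourier inversion *)

Section cosine_transform.
Context {R : realType}.
Local Notation leb := (@lebesgue_rV R).

Lemma cosD_pihalf_shift (a b : R) : cos (a + (b + pi / 2)) = - sin (a + b).
Proof. by rewrite addrA cosDpihalf. Qed.

Lemma derivable_phase (th t : R) : derivable (fun t => cos (t + th)) t 1.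
Proof.
apply: (@derivable_line _ _ _ _ cos _ _ (t + th) 1); last exact: derivable_cos.
by move=> h; rewrite addrA.
Qed.

Lemma derive1_phase (th : R) :
  derive1 (fun t => cos (t + th)) = (fun t => cos (t + (th + pi / 2))).
Proof.
apply/funext => t; rewrite cosD_pihalf_shift derive1E.
rewrite (@derive_line _ _ _ _ cos _ _ (t + th) 1).
  by have [_ ->] := is_derive_cos (t + th).
by move=> h; rewrite addrA.
Qed.

Lemma smooth1_phase n (th : R) : smooth1 n (fun t => cos (t + th)).
Proof.
elim: n th => [|n IH] th; (split; first by move=> t; exact: derivable_phase) => //.
by rewrite derive1_phase; exact: IH.
Qed.

Definition cosft m (th : R) (g : 'rV[R]_m -> R) (xi : 'rV[R]_m) : R :=
  \int[leb m]_y (cos (dotr xi y + th) * g y).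

Lemma test_phase m (th : R) xi (g : 'rV[R]_m -> R) : test_function g ->
  test_function (fun y => cos (dotr xi y + th) * g y).
Proof.
move=> tg; apply: (@test_mul _ _ (fun y => cos (dotr xi y + th))) => // n.
by apply: (@smooth_ridge _ m n (fun t => cos (t + th))); exact: smooth1_phase.
Qed.

Lemma integrable_phase m (th : R) xi (g : 'rV[R]_m -> R) : test_function g ->
  (leb m).-integrable setT (EFin \o (fun y => cos (dotr xi y + th) * g y)).
Proof. by move=> tg; apply: test_integrable; exact: test_phase. Qed.

Lemma le_norm_cosft m (g : 'rV[R]_m -> R) : test_function g ->
  exists M, forall th xi, `|cosft th g xi| <= M.
Proof.
move=> tg; exists (\int[leb m]_y `|g y|) => th xi.
apply: le_norm_Rintegral.
- exact: (test_measurable (test_phase _ _ tg)).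
- exact: (integrable_norm (test_integrable tg)).
- by move=> y; rewrite normrM ler_piMl// cos_max.
Qed.

Lemma cosft_parts m j th (xi : 'rV[R]_m) (g : 'rV[R]_m -> R) : test_function g ->
  xi 0 j * cosft (th + pi / 2) g xi = - cosft th (fun y => 'D_('e_j) g y) xi.
Proof.
move=> tg; apply/eqP; rewrite -addr_eq0; apply/eqP.
rewrite -RintegralZ; last exact: integrable_phase.
rewrite -RintegralD//; last 2 first.
- by apply: integrableZ; exact: integrable_phase.
- by apply: integrable_phase; exact: test_partial.
rewrite -[RHS](Rintegral_partial j (test_phase th xi tg)).
apply: eq_Rintegral => y _.
rewrite deriveM; last 2 first.
- apply: diff_derivable; apply: (@smooth_differentiable _ _ 0%N).
  by apply: (@smooth_ridge _ m 0 (fun t => cos (t + th))); exact: smooth1_phase.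
- by apply: diff_derivable; exact: smooth_differentiable (tg.1 0%N).
rewrite (@derive_ridge _ _ (fun t => cos (t + th))); last exact: derivable_phase.
by rewrite derive1_phase dotr_e /GRing.scale/=; ring.
Qed.

(** Each further power costs one integration by parts per coordinate. The phase shift this causes is
    harmless because the bound is uniform in [th]. *)
Lemma cosft_decay m k (g : 'rV[R]_m -> R) : test_function g ->
  exists M, forall th (xi : 'rV[R]_m), (1 + \sum_(j < m) `|xi 0 j|) ^+ k * `|cosft th g xi| <= M.
Proof.
elim: k g => [|k IH] g tg.
  by have [M MP] := le_norm_cosft tg; exists M => th xi; rewrite expr0 mul1r.
have [M MP] := IH _ tg.
have /choice[N NP] (j : 'I_m) := IH _ (test_partial j tg).
exists (M + \sum_(j < m) N j) => th xi.
rewrite exprSr -mulrA [(1 + _) * `|_|]mulrDl mul1r mulrDr lerD//.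
rewrite mulr_suml mulr_sumr; apply: ler_sum => j _.
rewrite -normrM -[th in cosft th](subrK (pi / 2)) cosft_parts// normrN.
exact: NP.
Qed.

Lemma mean_value_bound (f df : R -> R) (a c K : R) :
  (forall x : R, is_derive x (1 : R) f (df x)) ->
  (forall x, `|x - a| <= `|c - a| -> `|df x| <= K) -> `|f c - f a| <= K * `|c - a|.
Proof.
move=> dfP dfK.
have cf : continuous f.
  by move=> x; apply: differentiable_continuous; apply/derivable1_diffP; have [] := dfP x.
have [ac|ca|->] := ltgtP a c; last by rewrite !subrr normr0 mulr0.
  have [x] := MVT ac (fun x _ => dfP x) (continuous_subspaceT cf).
  rewrite in_itv/= => /andP[ax xc] ->; rewrite normrM ler_wpM2r//; apply: dfK.
  by rewrite !gtr0_norm ?subr_gt0// lerB// ltW.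
have [x] := MVT ca (fun x _ => dfP x) (continuous_subspaceT cf).
rewrite in_itv/= => /andP[cx xa]; rewrite distrC => ->.
rewrite normrM [`|c - a|]distrC ler_wpM2r//; apply: dfK.
by rewrite ![`|_ - a|]distrC !gtr0_norm ?subr_gt0// lerB// ltW.
Qed.

Lemma cosB_taylor (b t : R) : `|cos (b + t) - cos b - t * cos (b + pi / 2)| <= t ^+ 2.
Proof.
have sinle u : `|sin (b + u) - sin b| <= `|u|.
  have := @mean_value_bound sin cos b (b + u) 1 (fun x => is_derive_sin x).
  rewrite addrC addrA addNr add0r mul1r; apply => x _; exact: cos_max.
rewrite cosDpihalf.
(* The linear Taylor term is put into the function, whose derivative [sin b - sin x] is at most
   [|t|] between [b] and [b + t]. *)
have := @mean_value_bound (fun x => cos x + x * sin b) (fun x => - sin x + sin b) b (b + t) `|t|.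
rewrite (_ : cos (b + t) + _ - _ = cos (b + t) - cos b - t * - sin b); last by ring.
rewrite (_ : b + t - b = t); last by ring.
rewrite -expr2 real_normK ?num_real//; apply.
  move=> x.
  have [D1 D2] := is_deriveD (is_derive_cos x) (is_deriveZ (sin b) (is_derive_id x 1)).
  rewrite (_ : (fun x => _) = (cos : R -> R) + (sin b \*: id)); last first.
    by apply/funext => y; rewrite !fctE mulrC.
  by apply: DeriveDef => //; rewrite D2 /GRing.scale/= mulr1.
move=> x xt; rewrite addrC -normrN opprB; have := sinle (x - b).
by rewrite [b + _]addrC subrK => /le_trans; apply.
Qed.

Lemma sup_norm_coord m (x : 'rV[R]_m) j : `|x 0 j| <= `|x|.
Proof.
rewrite /Num.norm/= mx_normrE.
exact: (le_bigmax _ (fun ij => `|x ij.1 ij.2|) (0, j)).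
Qed.

Lemma le_norm_dotr m (x y : 'rV[R]_m) : `|dotr x y| <= `|x| * \sum_(j < m) `|y 0 j|.
Proof.
rewrite mulr_sumr (le_trans (ler_norm_sum _ _ _))//.
by apply: ler_sum => j _; rewrite normrM ler_wpM2r// sup_norm_coord.
Qed.

(** Differentiation under the integral sign with an explicit remainder: by [cosB_taylor] the
    increment of [cosft th g] differs from the linear map [dotr v] by a quadratic term, uniformly
    over the bounded support of [g]. *)
Lemma cosft_derive m th (g : 'rV[R]_m -> R) (xi : 'rV[R]_m) : test_function g ->
  differentiable (cosft th g) xi /\
  forall j, 'D_('e_j) (cosft th g) xi = cosft (th + pi / 2) (fun y => y 0 j * g y) xi.
Proof.
move=> tg.
pose gj j (y : 'rV[R]_m) := y 0 j * g y.
have tgj j : test_function (gj j).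
  by apply: test_mul => // n; exact: smooth_coord.
pose v : 'rV[R]_m := \row_j cosft (th + pi / 2) (gj j) xi.
have [M MP] := test_weight tg; have [_ [L gL]] := tg.
(* On the support of [g], [|dotr h y| <= |h| * m * |L|]; its square is the Taylor remainder and
   [|M| * weight y] dominates [g]. *)
pose C := \int[leb m]_y ((m%:R * `|L|) ^+ 2 * `|M| * weight y).
have quad h : `|(cosft th g (h + xi) - dotr v (h + xi)) - (cosft th g xi - dotr v xi)|
    <= C * `|h| ^+ 2.
  have vh : dotr v h = \int[leb m]_y (dotr h y * (cos (dotr xi y + (th + pi / 2)) * g y)).
    transitivity (\int[leb m]_y (\sum_(j < m) h 0 j * (cos (dotr xi y + (th + pi / 2)) * gj j y))).
      have : forall (r : seq 'I_m), (leb m).-integrable setT (EFin \o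
          (fun y => \sum_(j <- r) h 0 j * (cos (dotr xi y + (th + pi / 2)) * gj j y))) /\
        \int[leb m]_y (\sum_(j <- r) h 0 j * (cos (dotr xi y + (th + pi / 2)) * gj j y))
        = \sum_(j <- r) v 0 j * h 0 j.
        elim => [|j r [IH1 IH2]].
          split.
            rewrite (_ : _ \o _ = cst 0%E); first exact: integrable0.
            by apply/funext => y /=; rewrite big_nil.
          rewrite big_nil; under eq_Rintegral do rewrite big_nil.
          by rewrite Rintegral_cst// mul0r.
        have ij : (leb m).-integrable setT (EFin \o
            (fun y => h 0 j * (cos (dotr xi y + (th + pi / 2)) * gj j y))).
          by apply: integrableZ; exact: integrable_phase.
        split.
          rewrite (_ : _ \o _ = EFin \o (fun y => h 0 j * (cos (dotr xi y + (th + pi / 2)) * gj j y) +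
             \sum_(j <- r) h 0 j * (cos (dotr xi y + (th + pi / 2)) * gj j y))).
            exact: integrable_add.
          by apply/funext => y /=; rewrite big_cons.
        rewrite big_cons; under eq_Rintegral do rewrite big_cons.
        rewrite RintegralD// IH2 RintegralZ; last exact: integrable_phase.
        by rewrite mxE [in RHS]mulrC.
      by move=> /(_ (index_enum 'I_m))[_ ->].
    apply: eq_Rintegral => y _; rewrite /dotr mulr_suml; apply: eq_bigr => j _.
    by rewrite /gj; ring.
  have ih : (leb m).-integrable setT (EFin \o
      (fun y => dotr h y * (cos (dotr xi y + (th + pi / 2)) * g y))).
    rewrite (_ : _ \o _ = EFin \o (fun y => cos (dotr xi y + (th + pi / 2)) * (dotr h y * g y))).
      apply: integrable_phase; apply: test_mul => // n.
      apply: (@smooth_ridge _ m n id); exact: smooth1_id.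
    by apply/funext => y /=; congr EFin; ring.
  rewrite (_ : _ - _ = cosft th g (h + xi) - cosft th g xi - dotr v h); last by rewrite dotrD; ring.
  rewrite vh /cosft -RintegralB//; try exact: integrable_phase.
  rewrite -RintegralB//; last by apply: integrable_sub; exact: integrable_phase.
  rewrite [C * _]mulrC /C -RintegralZ; last first.
    by apply: integrableZ; exact: integrable_weight.
  apply: le_norm_Rintegral.
  - apply: (@integrable_measurable _ _ _ (leb m)).
    by apply: integrable_sub => //; apply: integrable_sub; exact: integrable_phase.
  - by apply: integrableZ; apply: integrableZ; exact: integrable_weight.
  move=> y.
  have -> : dotr (h + xi) y = dotr xi y + dotr h y by rewrite dotrC dotrD !(dotrC y) addrC.
  rewrite (_ : _ - _ = (cos ((dotr xi y + th) + dotr h y) - cos (dotr xi y + th) -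
    dotr h y * cos ((dotr xi y + th) + pi / 2)) * g y); last first.
    by rewrite [dotr xi y + dotr h y + th]addrAC [dotr xi y + (th + _)]addrA; ring.
  rewrite normrM.
  apply: (le_trans (ler_wpM2r (normr_ge0 _) (cosB_taylor _ _))).
  have [/forallP yL|] := boolP [forall j, `|y 0 j| <= L]; last first.
    rewrite negb_forall => /existsP[j]; rewrite -ltNge => /gL ->.
    rewrite normr0 mulr0 !mulr_ge0 ?exprn_ge0//; exact/ltW/weight_gt0.
  rewrite (_ : _ * (_ * _) = (`|h| ^+ 2 * (m%:R * `|L|) ^+ 2) * (`|M| * weight y)); last by ring.
  apply: ler_pM => //; first exact: sqr_ge0.
    rewrite -real_normK ?num_real// -exprMn lerXn2r ?nnegrE ?mulr_ge0//.
    apply: (le_trans (le_norm_dotr _ _)); rewrite ler_wpM2l//.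
    rewrite mulr_natl -[X in _ *+ X](card_ord m) -sumr_const; apply: ler_sum => j _.
    exact: le_trans (yL j) (ler_norm _).
  apply: (le_trans (MP y)); rewrite ler_wpM2r ?ler_norm//; exact/ltW/weight_gt0.
have [df d0] := @differentiable_quadratic R 'rV[R]_m (fun x => cosft th g x - dotr v x) xi C quad.
have eqf : cosft th g = (fun x => cosft th g x - dotr v x) + dotr v.
  by apply/funext => x; rewrite !fctE subrK.
have dv : differentiable (dotr v) xi by exact: differentiable_dotr.
split; first by rewrite eqf; exact: differentiableD.
move=> j; rewrite {1}eqf deriveD; [|exact: diff_derivable..].
rewrite d0 add0r (@derive_ridge _ _ id)// derive1_id mulr1 dotr_e mxE//.
Qed.

Lemma smooth_cosft m n th (g : 'rV[R]_m -> R) : test_function g -> smooth n (cosft th g).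
Proof.
elim: n th g => [|n IH] th g tg;
  (split; first by move=> x; exact: (cosft_derive th x tg).1) => //.
move=> j.
rewrite (_ : (fun _ => _) = cosft (th + pi / 2) (fun y => y 0 j * g y)).
  by apply: IH; apply: test_mul => // k; exact: smooth_coord.
by apply/funext => x; rewrite (cosft_derive th x tg).2.
Qed.

End cosine_transform.

(** * Inversion on the line through the Poisson kernel *)

Section inversion_one_variable.
Context {R : realType}.
Local Notation mu := (@lebesgue_measure R).

Lemma cvg_Rintegral d (T : measurableType d) (m : {measure set T -> \bar R})
    (D : set T) (f_ : nat -> T -> R) (f g : T -> R) : measurable D ->
  (forall n, measurable_fun D (f_ n)) -> measurable_fun D f ->
  m.-integrable D (EFin \o g) -> (forall n x, D x -> `|f_ n x| <= g x) ->
  (forall x, D x -> f_ n x @[n --> \oo] --> f x) ->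
  \int[m]_(x in D) f_ n x @[n --> \oo] --> \int[m]_(x in D) f x.
Proof.
move=> mD mf_ mf ig fg cf.
have [| | | | |iF _ H] := @dominated_convergence _ _ _ m D mD
  (fun n => EFin \o f_ n) (EFin \o f) (EFin \o g).
- by move=> n; exact/measurable_EFinP.
- exact/measurable_EFinP.
- apply: aeW => x Dx; apply/fine_cvgP; split; first exact: nearW.
  exact: cf.
- exact: ig.
- by apply: aeW => x n Dx; rewrite /= lee_fin fg.
have F := integrable_fin_num mD iF.
rewrite /Rintegral; apply: fine_cvg; rewrite fineK//.
Qed.

(** The Fourier integral of [exp (- e |x|)], that is the Poisson kernel of the half-plane scaled to
    total mass [2 * pi]. *)
Definition poisson (e t : R) : R := 2 * e / (e ^+ 2 + t ^+ 2).

Section exponential_kernel.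
Context (e : R) (e0 : 0 < e).

Let den_gt0 t : 0 < e ^+ 2 + t ^+ 2.
Proof. by rewrite ltr_pwDl ?exprn_gt0// sqr_ge0. Qed.

(** A primitive of [exp (- e x) (1 + cos (x t + th))]. The summand 1 makes the integrand
    nonnegative, as the fundamental theorem on a half-line used below requires; its contribution is
    subtracted again in [Rintegral_exp_phase]. *)
Let prim (t th x : R) : R := expR (- e * x) *
  (- e^-1 + (- e * cos (x * t + th) + t * sin (x * t + th)) / (e ^+ 2 + t ^+ 2)).

Let is_derive_prim (t th x : R) :
  is_derive x (1 : R) (prim t th) (expR (- e * x) * (1 + cos (x * t + th))).
Proof.
have dl (c d : R) : is_derive x (1 : R) (fun x => x * c + d) c.
  have [D1 D2] := is_deriveD (is_deriveZ c (is_derive_id x 1)) (is_derive_cst d x 1).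
  rewrite (_ : (fun x => _) = (c \*: id) + cst d); last first.
    by apply/funext => y; rewrite !fctE [in LHS]mulrC.
  by apply: DeriveDef => //; rewrite D2 addr0 /GRing.scale/= mulr1.
have dE := @is_derive1_comp R expR (fun x => x * (- e) + 0) x _ _ (is_derive_expR _) (dl _ _).
have dC := @is_derive1_comp R cos (fun x => x * t + th) x _ _ (is_derive_cos _) (dl _ _).
have dS := @is_derive1_comp R sin (fun x => x * t + th) x _ _ (is_derive_sin _) (dl _ _).
have dB := is_deriveD (is_derive_cst (- e^-1) x 1)
  (is_deriveZ (e ^+ 2 + t ^+ 2)^-1 (is_deriveD (is_deriveZ (- e) dC) (is_deriveZ t dS))).
have [D1 D2] := is_deriveM dE dB.
rewrite (_ : prim t th = (expR \o (fun x => x * (- e) + 0)) *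
  (cst (- e^-1) + (e ^+ 2 + t ^+ 2)^-1 \*:
    ((- e) \*: (cos \o (fun x => x * t + th)) + t \*: (sin \o (fun x => x * t + th)))));
  last first.
  apply/funext => y; rewrite /prim !fctE /= addr0 [- e * y]mulrC /GRing.scale/=; congr (_ * (_ + _)).
  by rewrite [in RHS]mulrC.
apply: DeriveDef => //; rewrite D2 !fctE /GRing.scale/= /GRing.scale/= !addr0 [- e * x]mulrC.
have h := lt0r_neq0 (den_gt0 t); have h2 := lt0r_neq0 e0.
set C := cos _; set S := sin _; set E := expR _.
by field; rewrite h h2.
Qed.

Let continuous_integrand (t th : R) :
  continuous (fun x => expR (- e * x) * (1 + cos (x * t + th)) : R).
Proof.
move=> x.
apply: cvgM.
  apply: continuous_comp; last exact: continuous_expR.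
  by apply: cvgMr; exact: cvg_id.
apply: cvgD; first exact: cvg_cst.
apply: continuous_comp; last exact: continuous_cos.
by apply: cvgD; [apply: cvgMl; exact: cvg_id|exact: cvg_cst].
Qed.

Let integral_half t th : (\int[mu]_(x in `[0%R, +oo[)
    (expR (- e * x) * (1 + cos (x * t + th)))%:E =
  (e^-1 + (e * cos th - t * sin th) / (e ^+ 2 + t ^+ 2))%:E)%E.
Proof.
have fct x : {for x, continuous (prim t th)}.
  by apply: differentiable_continuous; apply/derivable1_diffP; have [] := is_derive_prim t th x.
rewrite (@ge0_continuous_FTC2y _ _ (prim t th) 0 0).
- rewrite -EFinB /prim mulr0 expR0 mul1r mul0r add0r; congr EFin.
  rewrite !add0r; have h := lt0r_neq0 (den_gt0 t); have h2 := lt0r_neq0 e0.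
  by field; rewrite h h2.
- by move=> x _; rewrite mulr_ge0 ?expR_ge0// -lerBlDl sub0r cos_geN1.
- by apply: continuous_subspaceT; exact: continuous_integrand.
(* The second factor of [prim] is bounded by this constant [C], and [exp (- e x) <= 1 / (1 + e x)],
   so [prim] tends to 0. *)
- have C0 : 0 < e^-1 + (e + `|t|) / (e ^+ 2 + t ^+ 2).
    apply: ltr_pwDl; first by rewrite invr_gt0.
    by apply: divr_ge0; [rewrite addr_ge0// ltW|exact: ltW].
  set C := (X in 0 < X) in C0.
  apply/cvgr0Pnorm_lt => _/posnumP[d]; near=> x.
  have x0 : 0 < x by near: x; exact: nbhs_pinfty_gt.
  have h1 : expR (- e * x) <= (1 + e * x)^-1.
    rewrite mulNr expRN lef_pV2 ?posrE ?expR_gt0 ?addr_gt0 ?mulr_gt0//.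
    exact: expR_ge1Dx.
  have h2 : `|- e^-1 + (- e * cos (x * t + th) + t * sin (x * t + th)) / (e ^+ 2 + t ^+ 2)| <= C.
    apply: (le_trans (ler_normD _ _)); rewrite normrN gtr0_norm ?invr_gt0// lerD2l.
    rewrite normrM [`|_^-1|]gtr0_norm ?invr_gt0// ler_pM2r ?invr_gt0//.
    apply: (le_trans (ler_normD _ _)); rewrite !normrM normrN [`|e|]gtr0_norm//.
    by apply: lerD; rewrite ler_piMr ?cos_max ?sin_max// ltW.
  rewrite normrM ger0_norm ?expR_ge0//.
  apply: (le_lt_trans (ler_pM (expR_ge0 _) (normr_ge0 _) h1 h2)).
  rewrite mulrC ltr_pdivrMr ?addr_gt0 ?mulr_gt0// mulrDr mulr1.
  rewrite ltr_pwDl// mulrA mulrC -ler_pdivrMr ?mulr_gt0//.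
- by move=> x _; have [] := is_derive_prim t th x.
- by apply: cvg_at_right_filter; exact: fct.
- by move=> x _; rewrite derive1E; have [_ ->] := is_derive_prim t th x.
Unshelve. all: by end_near. Qed.

(** The reflection [x -> - x] turns the negative half-line into the positive one with [- t] for [t];
    the two sine terms then cancel. *)
Lemma integral_exp_phase t th :
  (\int[mu]_x (expR (- e * `|x|) * (1 + cos (x * t + th)))%:E =
  (2 / e + cos th * poisson e t)%:E)%E.
Proof.
pose f t (x : R) := (expR (- e * `|x|) * (1 + cos (x * t + th)))%:E.
have fge0 s x : (0 <= f s x)%E.
  rewrite lee_fin mulr_ge0 ?expR_ge0// -lerBlDl sub0r; exact: cos_geN1.
have mf s : measurable_fun setT (f s).
  apply/measurable_EFinP; apply: continuous_measurable_fun => x.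
  apply: cvgM.
    apply: continuous_comp; last exact: continuous_expR.
    by apply: cvgMr; apply: norm_continuous.
  apply: cvgD; first exact: cvg_cst.
  apply: continuous_comp; last exact: continuous_cos.
  by apply: cvgD; [apply: cvgMl; exact: cvg_id|exact: cvg_cst].
have halves : (\int[mu]_x f t x = \int[mu]_(x in `]-oo, 0%R]) f t x + \int[mu]_(x in `[0%R, +oo[) f t x)%E.
  rewrite -(@itv_setU_setT _ _ true (0 : R)) ge0_integral_setU//=.
  - congr (_ + _)%E; rewrite integral_itv_bndo_bndc//.
    exact: measurable_funTS.
  - by rewrite itv_setU_setT; exact: mf.
  - apply/disj_setPS => x [] /=; rewrite !in_itv/= andbT => x0.
    by rewrite leNgt x0.
have pos s : (\int[mu]_(x in `[0%R, +oo[) f s x =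
    (e^-1 + (e * cos th - s * sin th) / (e ^+ 2 + s ^+ 2))%:E)%E.
  rewrite -integral_half; apply: eq_integral => x; rewrite inE/= in_itv/= andbT => x0.
  by rewrite /f ger0_norm// mulNr.
rewrite -/(f t) halves pos.
have -> : (\int[mu]_(x in `]-oo, 0%R]) f t x = \int[mu]_(x in `[0%R, +oo[) f (- t)%R x)%E.
  rewrite ge0_integration_by_substitution0//; apply: eq_integral => x _.
  by rewrite /f normrN mulrNN.
rewrite pos -EFinD; congr EFin; rewrite /poisson sqrrN.
have h := lt0r_neq0 (den_gt0 t); have h2 := lt0r_neq0 e0.
by field; rewrite h h2.
Qed.

Let continuous_exp_abs (th t : R) : continuous (fun x : R => expR (- e * `|x|) * cos (x * t + th)).
Proof.
move=> x; apply: cvgM.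
  apply: continuous_comp; last exact: continuous_expR.
  by apply: cvgMr; apply: norm_continuous.
apply: continuous_comp; last exact: continuous_cos.
by apply: cvgD; [apply: cvgMl; exact: cvg_id|exact: cvg_cst].
Qed.

Let exp_abs_cos0 :
  (fun x : R => expR (- e * `|x|)) = (fun x => expR (- e * `|x|) * cos (x * 0 + 0)).
Proof. by apply/funext => x; rewrite mulr0 add0r cos0 mulr1. Qed.

(** At [t = th = 0] the factor [1 + cos 0] is 2, so twice the integral equals [4 / e]; this also
    excludes an infinite value. *)
Let exp_absE : (\int[mu]_x (expR (- e * `|x|))%:E = (2 / e)%:E)%E.
Proof.
have := integral_exp_phase 0 pi; rewrite cospi.
have := integral_exp_phase 0 0; rewrite cos0.
under eq_integral do rewrite mulr0 add0r cos0 mulrDr mulr1 EFinD.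
have e1 (x : R) : (0 <= (expR (- e * `|x|))%:E)%E by rewrite lee_fin expR_ge0.
have m1 : measurable_fun setT (fun x : R => (expR (- e * `|x|))%:E).
  apply/measurable_EFinP; rewrite exp_abs_cos0.
  by apply: continuous_measurable_fun; exact: continuous_exp_abs.
rewrite ge0_integralD//.
set I := integral _ _ _ => h _.
have : (I + I = (2 * (2 / e))%:E)%E.
  rewrite h; congr EFin; rewrite /poisson; have h2 := lt0r_neq0 e0.
  by field; rewrite h2.
have I0 : (0 <= I)%E by exact: integral_ge0.
case: I I0 {h} => [r _ [] rr|//|//].
congr EFin; lra.
Qed.

Lemma integrable_exp_abs : mu.-integrable setT (EFin \o (fun x : R => expR (- e * `|x|))).
Proof.
apply/integrableP; split.
  apply/measurable_EFinP; rewrite exp_abs_cos0.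
  by apply: continuous_measurable_fun; exact: continuous_exp_abs.
under eq_integral do rewrite /= ger0_norm ?expR_ge0//.
by rewrite exp_absE ltry.
Qed.

Lemma integrable_exp_phase (t th : R) :
  mu.-integrable setT (EFin \o (fun x : R => expR (- e * `|x|) * cos (x * t + th))).
Proof.
apply: dominated_integrable integrable_exp_abs _.
  by apply: continuous_measurable_fun; exact: continuous_exp_abs.
by move=> x; rewrite normrM ger0_norm ?expR_ge0// ler_piMr ?expR_ge0// cos_max.
Qed.

Lemma Rintegral_exp_phase t th :
  \int[mu]_x (expR (- e * `|x|) * cos (x * t + th)) = cos th * poisson e t.
Proof.
have := integral_exp_phase t th => /(congr1 fine) /=.
rewrite -/(Rintegral mu setT (fun x => expR (- e * `|x|) * (1 + cos (x * t + th)))).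
under eq_Rintegral do rewrite mulrDr mulr1.
rewrite RintegralD//; [|exact: integrable_exp_abs|exact: integrable_exp_phase].
by rewrite {1}/Rintegral exp_absE /= => /addrI.
Qed.

End exponential_kernel.

Lemma poisson_ge0 (e t : R) : 0 < e -> 0 <= poisson e t.
Proof. by move=> e0; rewrite divr_ge0 ?mulr_ge0 ?addr_ge0 ?sqr_ge0// ltW. Qed.

Lemma poisson_norm_le1 (e t : R) : 0 < e -> `|t| * poisson e t <= 1.
Proof.
move=> e0; rewrite /poisson mulrA ler_pdivrMr ?ltr_pwDl ?exprn_gt0 ?sqr_ge0//.
rewrite mul1r -[t ^+ 2]real_normK ?num_real// -subr_ge0.
rewrite (_ : _ - _ = (e - `|t|) ^+ 2) ?sqr_ge0//; ring.
Qed.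

Lemma continuous_poisson (e x : R) : 0 < e -> continuous (fun y => poisson e (y - x)).
Proof.
move=> e0 y; apply: cvgM; first exact: cvg_cst.
apply: cvgV; first by rewrite gt_eqF// ltr_pwDl ?exprn_gt0 ?sqr_ge0//.
apply: cvgD; first exact: cvg_cst.
by apply: cvgM; (apply: cvgB; [exact: cvg_id|exact: cvg_cst]).
Qed.

Lemma Rintegral_poisson (e x a b : R) : 0 < e -> a < b ->
  \int[mu]_(y in `[a, b]) poisson e (y - x) = 2 * (atan ((b - x) / e) - atan ((a - x) / e)).
Proof.
move=> e0 ab.
have dP (y : R) : is_derive y (1 : R) (fun y => 2 * atan ((y - x) / e)) (poisson e (y - x)).
  have [D1 D2] := is_deriveD (is_deriveZ e^-1 (is_derive_id y 1)) (is_derive_cst (- x / e) y 1).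
  have dl : is_derive y (1 : R) (fun y => (y - x) / e) e^-1.
    rewrite (_ : (fun y => _) = (e^-1 \*: id) + cst (- x / e)); last first.
      by apply/funext => z; rewrite !fctE mulrDl [z / e]mulrC.
    by apply: DeriveDef => //; rewrite D2 addr0 /GRing.scale/= mulr1.
  have dA := @is_derive1_comp R atan (fun y => (y - x) / e) y _ _ (is_derive1_atan _) dl.
  have [D3 D4] := is_deriveZ 2 dA.
  rewrite (_ : (fun y => _) = 2 \*: (atan \o (fun y => (y - x) / e)))//.
  apply: DeriveDef => //; rewrite D4 /poisson /GRing.scale/=.
  have h2 := lt0r_neq0 e0.
  have h : e ^+ 2 + (y - x) ^+ 2 != 0 by rewrite gt_eqF// ltr_pwDl ?exprn_gt0 ?sqr_ge0//.
  by field; rewrite h h2.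
have cF y : {for y, continuous (fun y => 2 * atan ((y - x) / e))}.
  by apply: differentiable_continuous; apply/derivable1_diffP; have [] := dP y.
rewrite /Rintegral (@continuous_FTC2 _ _ (fun y => 2 * atan ((y - x) / e)))//=.
- by rewrite mulrBr.
- by apply: continuous_subspaceT; exact: continuous_poisson.
- split => [y _||]; first by have [] := dP y.
  + by apply: cvg_at_right_filter; exact: cF.
  + by apply: cvg_at_left_filter; exact: cF.
- by move=> y _; rewrite derive1E; have [_ ->] := dP y.
Qed.

Lemma cvg_atan_scale (t : R) : 0 < t -> atan (t / n.+1%:R^-1) @[n --> \oo] --> pi / 2.
Proof.
move=> t0; apply: (@cvg_comp _ _ _ (fun n : nat => t / n.+1%:R^-1) atan _ +oo); last exact: cvgy_atan.
apply/cvgryPge => A; near=> n; rewrite invrK mulrC -ler_pdivrMr//.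
apply: (@le_trans _ _ n%:R); last by rewrite ler_nat.
by near: n; exact: nbhs_infty_ger.
Unshelve. all: by end_near. Qed.

(** On an interval [[-N, N]] containing [x] and the support, write [a y = (a y - a x) + a x]. The
    second term carries the mass of the kernel, an arctangent difference tending to [2 * pi]. In the
    first, the Lipschitz bound and [|t| * poisson e t <= 1] give the constant majorant [|K|], so
    dominated convergence applies although the kernel concentrates at [x]. *)
Lemma cvg_Rintegral_poisson (a : R -> R) (K L x : R) :
  (forall y z, `|a y - a z| <= K * `|y - z|) ->
  (forall y, L < `|y| -> a y = 0) ->
  \int[mu]_y (a y * poisson n.+1%:R^-1 (y - x)) @[n --> \oo] --> 2 * pi * a x.
Proof.
move=> aK aL; pose N := `|L| + `|x| + 1.
have ca : continuous a.
  move=> y; apply/cvgrPdist_le => /= e e0; near=> z.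
  rewrite (le_trans (aK _ _))//.
  apply: (@le_trans _ _ ((`|K| + 1) * `|y - z|)).
    by rewrite ler_wpM2r// (le_trans (ler_norm _))// lerDl.
  rewrite mulrC -ler_pdivlMr ?ltr_wpDl//.
  near: z; apply/nbhs_ballP; exists (e / (`|K| + 1)) => /=; first by rewrite divr_gt0 ?ltr_wpDl.
  by move=> z /ltW.
have xN : - N < x < N.
  by rewrite -ltr_norml /N; have := normr_ge0 L; lra.
have LN : L < N by rewrite /N; have := normr_ge0 x; have := ler_norm L; lra.
have N0 : - N < N by case/andP : xN; exact: lt_trans.
have n0 n : (0 : R) < n.+1%:R^-1 by rewrite invr_gt0.
have eqN n : \int[mu]_y (a y * poisson n.+1%:R^-1 (y - x)) =
    \int[mu]_(y in `[- N, N]) ((a y - a x) * poisson n.+1%:R^-1 (y - x)) +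
    a x * (2 * (atan ((N - x) / n.+1%:R^-1) - atan ((- N - x) / n.+1%:R^-1))).
  have cint (h : R -> R) : continuous h -> mu.-integrable `[- N, N] (EFin \o h).
    move=> ch; apply: continuous_compact_integrable; first exact: segment_compact.
    exact: continuous_subspaceT.
  rewrite -Rintegral_poisson// -RintegralZl//; last first.
    by apply: cint; exact: continuous_poisson.
  rewrite -RintegralD//; last 2 first.
  - apply: cint => y; apply: cvgM; last exact: continuous_poisson.
    by apply: cvgB; [exact: ca|exact: cvg_cst].
  - by apply: cint => y; apply: cvgM; [exact: cvg_cst|exact: continuous_poisson].
  rewrite [RHS]Rintegral_mkcond; apply: eq_Rintegral => y _.
  rewrite patchE; case: ifPn => [_|]; first by ring.
  rewrite notin_setE/= in_itv/= -ler_norml => /negP.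
  by rewrite -ltNge => Ny; rewrite aL ?mul0r// (lt_trans LN).
under eq_fun do rewrite eqN.
rewrite (_ : 2 * pi * a x = 0 + a x * (2 * (pi / 2 - - (pi / 2)))); last by field.
apply: cvgD; last first.
  apply: cvgMr; apply: cvgMr; apply: cvgB.
    by apply: cvg_atan_scale; rewrite subr_gt0; case/andP : xN.
  rewrite (_ : (fun n => _) = (fun n : nat => - atan ((x + N) / n.+1%:R^-1))); last first.
    by apply/funext => n; rewrite -atanN -mulNr; congr (atan (_ / _)); ring.
  apply: cvgN; apply: cvg_atan_scale; rewrite -ltrBlDr sub0r; case/andP : xN => //.
have {1}-> : (0 : R) = \int[mu]_(y in `[- N, N]) cst 0 y by rewrite Rintegral_cst// mul0r.
apply: (@cvg_Rintegral _ _ _ _ _ _ (cst `|K|)) => //.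
- move=> n; apply: measurable_funTS; apply: continuous_measurable_fun => y.
  apply: cvgM; last exact: continuous_poisson.
  by apply: cvgB; [exact: ca|exact: cvg_cst].
- apply: continuous_compact_integrable; first exact: segment_compact.
  by apply: continuous_subspaceT => ?; exact: cvg_cst.
- move=> n y _; rewrite normrM [`|poisson _ _|]ger0_norm ?poisson_ge0//.
  apply: (@le_trans _ _ (`|K| * (`|y - x| * poisson n.+1%:R^-1 (y - x)))).
    rewrite mulrA ler_wpM2r ?poisson_ge0// (le_trans (aK _ _))// ler_wpM2r//.
    exact: ler_norm.
  by rewrite ler_piMr// poisson_norm_le1.
move=> y _; have [->|yx] := eqVneq y x.
  by rewrite subrr; under eq_fun do rewrite mul0r; exact: cvg_cst.
have t0 : 0 < (y - x) ^+ 2 by rewrite exprn_even_gt0//= subr_eq0.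
rewrite /cst -(mulr0 (a y - a x)); apply: cvgMr.
apply: (@squeeze_cvgr _ _ _ _ (cst 0) (fun n : nat => 2 / (y - x) ^+ 2 * n.+1%:R^-1)).
- near=> n; rewrite poisson_ge0//= /poisson [leRHS]mulrAC.
  apply: ler_wpM2l; first by rewrite mulr_ge0// ltW.
  rewrite lef_pV2 ?posrE ?lerDr ?sqr_ge0//.
  by apply: ltr_pwDl; rewrite ?sqr_ge0// exprn_gt0.
- exact: cvg_cst.
- rewrite -[X in _ --> X](mulr0 (2 / (y - x) ^+ 2)); apply: cvgMr; exact: (@cvg_harmonic R).
Unshelve. all: by end_near. Qed.

Lemma integrable_prod_mul d1 d2 (T1 : measurableType d1) (T2 : measurableType d2)
    (m1 : {sigma_finite_measure set T1 -> \bar R})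
    (m2 : {sigma_finite_measure set T2 -> \bar R}) (f : T1 -> R) (g : T2 -> R) :
  m1.-integrable setT (EFin \o f) -> m2.-integrable setT (EFin \o g) ->
  (m1 \x m2)%E.-integrable setT (EFin \o (fun z => f z.1 * g z.2)).
Proof.
move=> iF ig; have mf := integrable_measurable iF; have mg := integrable_measurable ig.
apply/integrable12ltyP.
  apply/measurable_EFinP; apply: measurable_funM.
    exact: (measurableT_comp mf measurable_fst).
  exact: (measurableT_comp mg measurable_snd).
have mng : measurable_fun setT (fun y => (`|g y|)%:E).
  by apply/measurable_EFinP; exact: measurableT_comp.
have g1 x : (\int[m2]_y `|(EFin \o (fun z : T1 * T2 => f z.1 * g z.2)%R) (x, y)| =
    (`|f x|)%:E * \int[m2]_y (`|g y|)%:E)%E.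
  under eq_integral do rewrite /= normrM EFinM.
  by rewrite ge0_integralZl.
under eq_integral do rewrite g1.
rewrite ge0_integralZr//.
- apply: lte_mul_pinfty; first exact: integral_ge0.
  + rewrite ge0_fin_numE; last exact: integral_ge0.
    by move/integrableP : iF => [_].
  + by move/integrableP : ig => [_].
- by apply/measurable_EFinP; exact: measurableT_comp.
- exact: integral_ge0.
Qed.

Lemma lipschitz_continuous (V W : normedModType R) (a : V -> W) (K : R) :
  (forall y z, `|a y - a z| <= K * `|y - z|) -> continuous a.
Proof.
move=> aK y; apply/cvgrPdist_le => /= e e0; near=> z.
rewrite (le_trans (aK _ _))//.
apply: (@le_trans _ _ ((`|K| + 1) * `|y - z|)).
  by rewrite ler_wpM2r// (le_trans (ler_norm _))// lerDl.
rewrite mulrC -ler_pdivlMr ?ltr_wpDl//.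
near: z; apply/nbhs_ballP; exists (e / (`|K| + 1)) => /=; first by rewrite divr_gt0 ?ltr_wpDl.
by move=> z; rewrite -ball_normE => /ltW.
Unshelve. all: by end_near. Qed.

Lemma lipschitz_integrable (a : R -> R) (K L : R) :
  (forall y z, `|a y - a z| <= K * `|y - z|) -> (forall y, L < `|y| -> a y = 0) ->
  mu.-integrable setT (EFin \o a).
Proof.
move=> aK aL; have ca := lipschitz_continuous aK.
(* Since [a] vanishes at [N], [|K| * (N + N)] bounds it on [[-N, N]]; the factor [1 + N ^ 2]
   compensates the majorant [1 / (1 + y ^ 2)] there. *)
pose N := `|L| + 1; pose C := `|K| * (N + N) * (1 + N ^+ 2).
have LN : L < `|N| by rewrite ger0_norm ?addr_ge0// (le_lt_trans (ler_norm _))// ltrDl.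
apply: (@dominated_integrable _ _ _ mu a (fun y => C * (1 + y ^+ 2)^-1)).
- exact: continuous_measurable_fun.
- by apply: integrableZ; exact: integrable_inv1Dsqr.
move=> y; have D0 : 0 < 1 + y ^+ 2 by rewrite ltr_wpDr// sqr_ge0.
have N0 : 0 <= N by rewrite addr_ge0.
have [yN|Ny] := leP `|y| N; last first.
  rewrite aL; last by rewrite (lt_trans LN)// ger0_norm.
  by rewrite normr0 mulr_ge0 ?invr_ge0 ?(ltW D0)// !mulr_ge0 ?addr_ge0 ?sqr_ge0.
rewrite -[a y]subr0 -(aL _ LN) (le_trans (aK _ _))//.
apply: (@le_trans _ _ (`|K| * `|y - N|)); first by rewrite ler_wpM2r// ler_norm.
rewrite ler_pdivlMr//; apply: ler_pM; rewrite ?mulr_ge0 ?(ltW D0)//.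
  rewrite ler_wpM2l// (le_trans (ler_normB _ _))// lerD//.
  by rewrite ger0_norm.
by rewrite lerD2l -[y ^+ 2]real_normK ?num_real// lerXn2r.
Qed.

(* Abel summation of the outer integral by [exp (- |xi| / n)]: after Fubini the
   kernel becomes the Poisson kernel, an approximate identity. *)
Lemma inversion1 (a b : R -> R) (K L x : R) :
  (forall y z, `|a y - a z| <= K * `|y - z|) -> (forall y, L < `|y| -> a y = 0) ->
  (forall y z, `|b y - b z| <= K * `|y - z|) -> (forall y, L < `|y| -> b y = 0) ->
  let J xi := \int[mu]_y (cos (xi * (y - x)) * a y + cos (xi * (y - x) + pi / 2) * b y) in
  mu.-integrable setT (EFin \o J) -> \int[mu]_xi J xi = 2 * pi * a x.
Proof.
move=> aK aL bK bL J iJ.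
have ia := lipschitz_integrable aK aL; have ib := lipschitz_integrable bK bL.
have ca := lipschitz_continuous aK; have cb := lipschitz_continuous bK.
pose c y := `|a y| + `|b y|.
have ic : mu.-integrable setT (EFin \o c).
  by apply: integrable_add; exact: integrable_norm.
pose F (z : R * R) := cos (z.1 * (z.2 - x)) * a z.2 + cos (z.1 * (z.2 - x) + pi / 2) * b z.2.
have mc (h : R -> R) (u : R * R -> R) : continuous h -> measurable_fun setT u ->
    measurable_fun setT (fun z => h (u z)).
  by move=> ch mu'; apply: (@measurableT_comp _ _ _ _ _ _ h) => //; exact: continuous_measurable_fun.
have m1 : measurable_fun setT (fun z : R * R => z.1) by exact: measurable_fst.
have m2 : measurable_fun setT (fun z : R * R => z.2) by exact: measurable_snd.
have m12 : measurable_fun setT (fun z : R * R => z.1 * (z.2 - x)).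
  by apply: measurable_funM => //; apply: measurable_funB.
have mF : measurable_fun setT F.
  apply: measurable_funD; apply: measurable_funM; try exact: mc.
    by apply: (mc cos); [exact: continuous_cos|].
  by apply: (mc cos); [exact: continuous_cos|exact: measurable_funD].
have Fc z : `|F z| <= c z.2.
  apply: (le_trans (ler_normD _ _)); rewrite !normrM.
  by apply: lerD; rewrite ler_piMl// cos_max.
have iFx xi : mu.-integrable setT (EFin \o (fun y => F (xi, y))).
  apply: (dominated_integrable _ ic) => [|y]; last exact: (Fc (xi, y)).
  apply: (@measurableT_comp _ _ _ _ _ _ F _ (fun y => (xi, y))) => //.
  exact: measurable_pair1.
pose ex (n : nat) (xi : R) := expR (- n.+1%:R^-1 * `|xi|).
have n0 n : (0 : R) < n.+1%:R^-1 by rewrite invr_gt0.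
have iex n := integrable_exp_abs (n0 n).
have mex n : measurable_fun setT (ex n) by exact: integrable_measurable (iex n).
have step n : \int[mu]_xi (ex n xi * J xi) = \int[mu]_y (a y * poisson n.+1%:R^-1 (y - x)).
  pose G (z : R * R) := ex n z.1 * F z.
  have iG : (mu \x mu)%E.-integrable setT (EFin \o G).
    apply: (dominated_integrable _ (integrable_prod_mul (iex n) ic)) => [|z].
      by apply: measurable_funM => //; exact: (measurableT_comp (mex n) m1).
    by rewrite /G normrM ger0_norm ?expR_ge0// ler_wpM2l ?expR_ge0.
  transitivity (\int[mu]_xi \int[mu]_y G (xi, y)).
    by apply: eq_Rintegral => xi _; rewrite /J -RintegralZ//; exact: iFx.
  rewrite (Rintegral_prod iG) -(Rintegral_prod2 iG); apply: eq_Rintegral => y _.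
  transitivity (\int[mu]_xi (a y * (ex n xi * cos (xi * (y - x) + 0)) +
      b y * (ex n xi * cos (xi * (y - x) + pi / 2)))).
    by apply: eq_Rintegral => xi _; rewrite /G /F/= addr0; ring.
  rewrite RintegralD//; last 2 first.
  - by apply: integrableZ; exact: integrable_exp_phase.
  - by apply: integrableZ; exact: integrable_exp_phase.
  rewrite !RintegralZ; [|exact: integrable_exp_phase..].
  (* The regulariser is even, so the phase [pi / 2] yields the factor [cos (pi / 2) = 0] and [b]
     drops out. *)
  by rewrite !Rintegral_exp_phase// cos0 cos_pihalf mul1r mul0r mulr0 addr0.
have lim1 : \int[mu]_xi (ex n xi * J xi) @[n --> \oo] --> 2 * pi * a x.
  by under eq_fun do rewrite step; exact: cvg_Rintegral_poisson aK aL.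
have lim2 : \int[mu]_xi (ex n xi * J xi) @[n --> \oo] --> \int[mu]_xi J xi.
  have mJ := integrable_measurable iJ.
  apply: (cvg_Rintegral _ _ _ (integrable_norm iJ)) => //.
  - by move=> n; apply: measurable_funM; [exact: mex|exact: mJ].
  - move=> n xi _; rewrite normrM ler_piMl// ger0_norm ?expR_ge0//.
    by rewrite -(expR0 R) ler_expR mulNr oppr_le0 mulr_ge0// ltW.
  move=> xi _; rewrite -[X in _ --> X]mul1r; apply: cvgM; last exact: cvg_cst.
  rewrite -[X in _ --> X](expR0 R); apply: continuous_cvg; first exact: continuous_expR.
  rewrite -[X in _ --> X](mul0r `|xi|); apply: cvgMl.
  by rewrite -oppr0; apply: cvgN; exact: (@cvg_harmonic R).
exact: (cvg_unique _ lim2 lim1).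
Qed.

End inversion_one_variable.

(** * Inversion in every dimension *)

Section inversion.
Context {R : realType}.
Local Notation mu := (@lebesgue_measure R).
Local Notation leb := (@lebesgue_rV R).

(** Applied with [al = - dotr xi x], it reduces a phase that varies with [xi] to the two fixed
    phases [th] and [th + pi / 2]. *)
Lemma cosft_shift m th al (g : 'rV[R]_m -> R) xi : test_function g ->
  cosft (th + al) g xi = cos al * cosft th g xi + sin al * cosft (th + pi / 2) g xi.
Proof.
move=> tg; rewrite /cosft -!RintegralZ; [|exact: integrable_phase..].
rewrite -RintegralD//; [|by apply: integrableZ; exact: integrable_phase..].
apply: eq_Rintegral => y _.
set t := dotr xi y; rewrite (addrA t th al) (addrA t th (pi / 2)) cosDpihalf [cos (t + th + al)]cosD.
set u := t + th.
ring.
Qed.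

Lemma weight_cons_le m (a : R) (v : 'rV[R]_m) : weight (rV_cons (a, v)) <= weight v.
Proof.
rewrite weight_cons ler_piMl//; first exact/ltW/weight_gt0.
by rewrite invf_le1 ?lerDl ?sqr_ge0// ltr_wpDr// sqr_ge0.
Qed.

(** Converts polynomial decay of order [2 * m] into domination by [weight]: two powers per
    coordinate, as [1 + t ^ 2 <= (1 + s) ^ 2] for [0 <= t <= s]. *)
Lemma weight_lower m (x : 'rV[R]_m) (s : R) : 0 <= s -> (forall j, `|x 0 j| <= s) ->
  1 <= (1 + s) ^+ (2 * m) * weight x.
Proof.
move=> s0 xs; rewrite /weight prodfV ler_pdivlMr; last first.
  by apply: prodr_gt0 => i _; rewrite ltr_wpDr// sqr_ge0.
rewrite mul1r exprM -[X in _ ^+ X](card_ord m) -prodr_const.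
apply: ler_prod => j _; rewrite addr_ge0 ?sqr_ge0//=.
rewrite -[x 0 j ^+ 2]real_normK ?num_real//; have := xs j; have := normr_ge0 (x 0 j).
set t := `|_| => t0 ts.
rewrite -subr_ge0 (_ : _ - _ = 2 * s + (s - t) * (s + t)); last by ring.
by rewrite addr_ge0 ?mulr_ge0 ?subr_ge0 ?addr_ge0.
Qed.

Lemma cosft_weight m (g : 'rV[R]_m -> R) : test_function g ->
  exists M, forall th xi, `|cosft th g xi| <= M * weight xi.
Proof.
move=> tg; have [M MP] := cosft_decay (2 * m) tg; exists M => th xi.
apply: le_trans (ler_wpM2r (ltW (weight_gt0 xi)) (MP th xi)).
rewrite mulrAC ler_peMl//; apply: weight_lower => [|j]; first by rewrite sumr_ge0.
by rewrite (bigD1 j)//= lerDl sumr_ge0.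
Qed.

Lemma measurable_cosft m th (x : 'rV[R]_m) (g : 'rV[R]_m -> R) : test_function g ->
  measurable_fun setT (fun xi => cosft (th - dotr xi x) g xi).
Proof.
move=> tg; under eq_fun do rewrite cosft_shift//.
have mphase al : measurable_fun setT (fun xi : 'rV[R]_m => cos (dotr x xi + al)).
  apply: measurable_rV_continuous; apply: (@smooth_continuous _ _ 0%N).
  by apply: (@smooth_ridge _ m 0 (fun t => cos (t + al))); exact: smooth1_phase.
have mc th' : measurable_fun setT (cosft th' g).
  by apply: measurable_rV_continuous; exact: (smooth_continuous (smooth_cosft 0%N th' tg)).
rewrite (_ : (fun xi => _) = (fun xi => cos (dotr x xi + 0) * cosft th g xi +
    cos (dotr x xi + pi / 2) * cosft (th + pi / 2) g xi)).
  by apply: measurable_funD; apply: measurable_funM.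
by apply/funext => xi; rewrite cosN sinN addr0 cosDpihalf dotrC.
Qed.

Lemma integrable_cosft m th (x : 'rV[R]_m) (g : 'rV[R]_m -> R) : test_function g ->
  (leb m).-integrable setT (EFin \o (fun xi => cosft (th - dotr xi x) g xi)).
Proof.
move=> tg; have [M MP] := cosft_weight tg.
by apply: (@weight_integrable _ _ _ M) => //; exact: measurable_cosft.
Qed.

(** Supplies the Lipschitz hypotheses of [inversion1], with one constant for all phases and
    frequencies. The mean value theorem is applied in the first coordinate, and the factor of
    [weight] belonging to that coordinate is bounded by 1. *)
Lemma cosft_slice_lipschitz m (g : 'rV[R]_m.+1 -> R) : test_function g ->
  exists K, forall th (xi : 'rV[R]_m) y z,
    `|cosft th (fun v => g (rV_cons (y, v))) xi - cosft th (fun v => g (rV_cons (z, v))) xi|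
      <= K * `|y - z|.
Proof.
move=> tg; have [M MP] := test_weight (test_partial ord0 tg).
exists (\int[leb m]_v (`|M| * weight v)) => th xi y z.
have ts t := test_slice t tg.
rewrite /cosft -RintegralB//; [|exact: integrable_phase..].
rewrite mulrC -RintegralZ; last by apply: integrableZ; exact: integrable_weight.
apply: le_norm_Rintegral.
- apply: (@integrable_measurable _ _ _ (leb m)).
  by apply: integrable_sub; exact: integrable_phase.
- by apply: integrableZ; apply: integrableZ; exact: integrable_weight.
move=> v; rewrite -mulrBr normrM.
apply: (@le_trans _ _ `|g (rV_cons (y, v)) - g (rV_cons (z, v))|).
  by rewrite ler_piMl// cos_max.
rewrite mulrC.
apply: (@mean_value_bound _ (fun t => g (rV_cons (t, v))) (fun t => 'D_('e_ord0) g (rV_cons (t, v)))).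
  move=> t; apply: DeriveDef.
    by apply: derivable_slice0 => ?; exact: (tg.1 0%N).1.
  by rewrite -derive1E derive1_slice0.
move=> t _; apply: (le_trans (MP _)).
apply: (@le_trans _ _ (`|M| * weight (rV_cons (t, v)))).
  by rewrite ler_wpM2r ?ler_norm// ltW// weight_gt0.
by rewrite ler_wpM2l// weight_cons_le.
Qed.

Lemma dotr_cons m (a b : R) (u v : 'rV[R]_m) :
  dotr (rV_cons (a, u)) (rV_cons (b, v)) = a * b + dotr u v.
Proof.
rewrite /dotr big_ord_recl !rV_cons0; congr (_ + _).
by apply: eq_bigr => i _; rewrite !rV_consS.
Qed.

(** Fubini puts the first frequency innermost. With the other frequencies [xi] fixed, the transform
    is a one-variable integral of partial transforms of slices, to which [inversion1] applies; what
    remains is the statement for the slice through [x0], one dimension lower. *)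
Lemma inversion m th (x : 'rV[R]_m) (g : 'rV[R]_m -> R) : test_function g ->
  \int[leb m]_xi cosft (th - dotr xi x) g xi = (2 * pi) ^+ m * cos th * g x.
Proof.
elim: m th x g => [|m IH] th x g tg.
  have d0 (f : 'rV[R]_0 -> R) : measurable_fun setT f -> \int[leb 0]_x f x = f 0.
    move=> mf; rewrite /Rintegral [leb 0]/= integral_dirac//; last exact/measurable_EFinP.
    by rewrite diracE in_setT mul1e.
  rewrite d0; last exact: measurable_cosft.
  rewrite /cosft d0; last exact: (test_measurable (test_phase _ _ tg)).
  by rewrite /dotr !big_ord0 subr0 add0r expr0 mul1r (thinmx0 x).
pose x0 : R := x 0 ord0; pose x' : 'rV[R]_m := (rV_uncons x).2.
have xE : x = rV_cons (x0, x') by rewrite -[LHS]rV_unconsK.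
have iC := integrable_cosft th x tg.
rewrite Rintegral_rV_cons// (Rintegral_prod (integrable_rV_cons iC)).
rewrite -(Rintegral_prod2 (integrable_rV_cons iC)) /=.
have ts t := test_slice t tg.
have [K KP] := cosft_slice_lipschitz tg.
have [_ [L gL]] := tg.
have [M MP] := cosft_weight tg.
transitivity (\int[leb m]_xi (2 * pi * cosft (th - dotr xi x') (fun v => g (rV_cons (x0, v))) xi)).
  apply: eq_Rintegral => xi _.
  pose th' := th - dotr xi x'.
  (* The addition formula splits the full phase into [xi0 * (y - x0)] and a rest [B]. The cosine of
     [B] gives [a]; its sine, rewritten as [cos (B - pi / 2)], gives [b]. *)
  pose a y := cosft th' (fun v => g (rV_cons (y, v))) xi.
  pose b y := cosft (th' - pi / 2) (fun v => g (rV_cons (y, v))) xi.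
  have JE xi0 : cosft (th - dotr (rV_cons (xi0, xi)) x) g (rV_cons (xi0, xi)) =
      \int[mu]_y (cos (xi0 * (y - x0)) * a y + cos (xi0 * (y - x0) + pi / 2) * b y).
    rewrite [LHS]/cosft Rintegral_rV_cons; last exact: integrable_phase.
    apply: eq_Rintegral => y _.
    rewrite /a /b /cosft -!RintegralZ; [|exact: integrable_phase..].
    rewrite -RintegralD//; [|by apply: integrableZ; exact: integrable_phase..].
    apply: eq_Rintegral => v _.
    rewrite xE !dotr_cons cosDpihalf /th'.
    rewrite (_ : _ + (th - _) = xi0 * (y - x0) + (dotr xi v + (th - dotr xi x'))); last by ring.
    rewrite (addrA (dotr xi v) (th - _)); set B := dotr xi v + (th - _); rewrite cosD.
    have -> : cos (B - pi / 2) = sin B.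
      by rewrite -cosN opprB addrC cosDpihalf sinN opprK.
    by ring.
  under eq_Rintegral do rewrite JE.
  have supp th'' y : L < `|y| -> cosft th'' (fun v => g (rV_cons (y, v))) xi = 0.
    move=> yL; rewrite /cosft (_ : (fun v => _) = cst 0) ?Rintegral_cst ?mul0r//.
    by apply/funext => v; rewrite (gL _ ord0) ?mulr0// rV_cons0.
  apply: (@inversion1 _ a b K L x0) => //; try by move=> *; exact: KP.
  - by move=> y; exact: supp.
  - by move=> y; exact: supp.
  rewrite (_ : _ \o _ = EFin \o (fun xi0 => cosft (th - dotr (rV_cons (xi0, xi)) x) g (rV_cons (xi0, xi)))); last first.
    by apply/funext => xi0 /=; rewrite JE.
  apply: (@dominated_integrable _ _ _ mu _ (fun xi0 => M * weight xi * (1 + xi0 ^+ 2)^-1)).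
  - apply: (@measurableT_comp _ _ _ _ _ _ (fun z => cosft (th - dotr z x) g z) _
      (fun xi0 => rV_cons (xi0, xi))); first exact: measurable_cosft.
    apply: (@measurableT_comp _ _ _ _ _ _ (@rV_cons R m) _ (fun xi0 => (xi0, xi))).
      exact: measurable_rV_cons.
    exact: measurable_pair2.
  - by apply: integrableZ; exact: integrable_inv1Dsqr.
  - by move=> xi0; apply: (le_trans (MP _ _)); rewrite weight_cons mulrA mulrAC.
rewrite RintegralZ; last exact: integrable_cosft.
by rewrite IH// -xE exprS !mulrA.
Qed.

End inversion.

(** * Test functions as Fourier transforms of Schwartz functions *)

Section schwartz_preimage.
Context {R : realType} {m : nat}.
Local Notation leb := (@lebesgue_rV R m).
Implicit Types (p q : 'rV[R]_m -> R).

Lemma le_normc (z : R[i]) : normc z <= `|complex.Re z| + `|complex.Im z|.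
Proof.
case: z => a b /=.
rewrite -[leRHS]ger0_norm ?addr_ge0// -sqrtr_sqr ler_wsqrtr// sqrrD.
by rewrite !real_normK ?num_real// lerD2r lerDl mulrn_wge0// mulr_ge0.
Qed.

Lemma normc_ge0 (z : R[i]) : 0 <= normc z.
Proof. by case: z => a b; exact: sqrtr_ge0. Qed.

Lemma le_Re_normc (z : R[i]) : `|complex.Re z| <= normc z.
Proof. by case: z => a b /=; rewrite -sqrtr_sqr ler_wsqrtr// lerDl sqr_ge0. Qed.

Lemma le_Im_normc (z : R[i]) : `|complex.Im z| <= normc z.
Proof. by case: z => a b /=; rewrite -sqrtr_sqr ler_wsqrtr// lerDr sqr_ge0. Qed.

Lemma sqr_normc (z : R[i]) : normc z ^+ 2 = complex.Re z ^+ 2 + complex.Im z ^+ 2.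
Proof. by case: z => a b /=; rewrite sqr_sqrtr// addr_ge0 ?sqr_ge0. Qed.

Lemma enorm_ge0 (x : 'rV[R]_m) : 0 <= enorm x.
Proof. exact: sqrtr_ge0. Qed.

Lemma le_enorm (x : 'rV[R]_m) : enorm x <= \sum_(j < m) `|x 0 j|.
Proof.
have S0 : 0 <= \sum_(j < m) `|x 0 j| by rewrite sumr_ge0.
rewrite -[leRHS]ger0_norm// -sqrtr_sqr ler_wsqrtr// expr2 mulr_suml.
apply: ler_sum => j _; rewrite -expr2 -real_normK ?num_real// expr2 ler_wpM2l//.
by rewrite (bigD1 j)//= lerDl sumr_ge0.
Qed.

Lemma le_coord_enorm (x : 'rV[R]_m) j : `|x 0 j| <= enorm x.
Proof.
rewrite -sqrtr_sqr ler_wsqrtr// /dotr (bigD1 j)//= -expr2 lerDl.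
by apply: sumr_ge0 => i _; rewrite -expr2 sqr_ge0.
Qed.

Definition ctest (f : 'rV[R]_m -> R[i]) : Prop :=
  test_function (fun x => complex.Re (f x)) /\ test_function (fun x => complex.Im (f x)).

(** The form shared by the real and imaginary parts of the preimage and all their derivatives:
    differentiation shifts the phases and multiplies [p] and [q] by a coordinate. *)
Let cosft_sum (f : 'rV[R]_m -> R) : Prop := exists th1 p th2 q,
  [/\ test_function p, test_function q & f = fun xi => cosft th1 p xi + cosft th2 q xi].

Let cosft_sum_partial i f : cosft_sum f -> cosft_sum (fun x => 'D_('e_i) f x).
Proof.
move=> [th1 [p [th2 [q [tp tq ->]]]]].
have tx g : test_function g -> test_function (fun y : 'rV[R]_m => y 0 i * g y).
  by move=> tg; apply: test_mul => // n; exact: smooth_coord.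
exists (th1 + pi / 2), (fun y : 'rV[R]_m => y 0 i * p y), (th2 + pi / 2),
  (fun y : 'rV[R]_m => y 0 i * q y).
split; [exact: tx|exact: tx|].
apply/funext => x; have [d1 e1] := cosft_derive th1 x tp; have [d2 e2] := cosft_derive th2 x tq.
by rewrite deriveD; [rewrite e1 e2|exact: diff_derivable..].
Qed.

Let cosft_sum_decay k f : cosft_sum f -> exists M, forall x, (1 + enorm x) ^+ k * `|f x| <= M.
Proof.
move=> [th1 [p [th2 [q [tp tq ->]]]]].
have [M MP] := cosft_decay k tp; have [N NP] := cosft_decay k tq.
exists (M + N) => x; apply: (@le_trans _ _ ((1 + \sum_(j < m) `|x 0 j|) ^+ k *
   (`|cosft th1 p x| + `|cosft th2 q x|))).
  apply: ler_pM => //; rewrite ?exprn_ge0 ?addr_ge0 ?enorm_ge0 ?ler_normD//.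
  by rewrite lerXn2r ?nnegrE ?addr_ge0 ?enorm_ge0 ?sumr_ge0// lerD2l le_enorm.
by rewrite mulrDr lerD.
Qed.

Lemma cosft_schwartz (th1 th2 th3 th4 : R) p q p' q' : test_function p -> test_function q ->
  test_function p' -> test_function q' ->
  is_schwartz (fun xi => (cosft th1 p xi + cosft th2 q xi) +i* (cosft th3 p' xi + cosft th4 q' xi)).
Proof.
move=> tp tq tp' tq'; split.
  by apply/csmoothP => n; split; apply: smooth_add; exact: smooth_cosft.
move=> k a.
set f : 'rV[R]_m -> R[i] := fun xi => (cosft th1 p xi + _) +i* _.
have [sR sI] : cosft_sum (fun x => complex.Re (cpartials a f x)) /\
               cosft_sum (fun x => complex.Im (cpartials a f x)).
  elim: a => [|i a [IH1 IH2]]; first by split; [exists th1, p, th2, q|exists th3, p', th4, q'].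
  by split; exact: cosft_sum_partial.
have [M MP] := cosft_sum_decay k sR; have [N NP] := cosft_sum_decay k sI.
exists (M + N) => x; apply: le_trans (lerD (MP x) (NP x)).
by rewrite -mulrDr ler_wpM2l ?exprn_ge0 ?addr_ge0 ?enorm_ge0// le_normc.
Qed.

Lemma cosftN th p xi : test_function p -> cosft th (fun y => - p y) xi = - cosft th p xi.
Proof.
move=> tp; rewrite -mulN1r /cosft -RintegralZ; last exact: integrable_phase.
by apply: eq_Rintegral => y _; rewrite mulN1r mulrN.
Qed.

Lemma fourier_preimage (phi : 'rV[R]_m -> R[i]) : ctest phi ->
  exists psi : schwartz R m, fourier psi = phi.
Proof.
move=> [tp tq]; pose c : R := Num.sqrt (2 * pi) ^- m.
pose p x := c * complex.Re (phi x); pose q x := c * complex.Im (phi x).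
have {tp} tp : test_function p by apply: (@test_mul _ _ (fun=> c)) => // n; exact: smooth_cst.
have {tq} tq : test_function q by apply: (@test_mul _ _ (fun=> c)) => // n; exact: smooth_cst.
(* The inverse transform of [phi] in real terms: since [cos (t + pi / 2) = - sin t], the real part
   of [exp (i t) (p + i q)] uses [p] at phase 0 and [q] at phase [pi / 2], the imaginary part [q]
   and [- p]. *)
have sp := cosft_schwartz 0 (pi / 2) 0 (pi / 2) tp tq tq (test_opp tp).
have sp' := asboolT sp.
exists (Schwartz sp'); apply/funext => x.
have pi2 : (pi / 2 + pi / 2 : R) = pi by rewrite -splitr.
have s0 g xi : test_function g -> cosft (0 - dotr xi x) g xi =
    cos (dotr x xi) * cosft 0 g xi - sin (dotr x xi) * cosft (pi / 2) g xi.
  by move=> tg; rewrite cosft_shift// cosN sinN mulNr add0r dotrC.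
have s1 g xi : test_function g -> cosft (pi / 2 - dotr xi x) g xi =
    cos (dotr x xi) * cosft (pi / 2) g xi + sin (dotr x xi) * cosft 0 g xi.
  move=> tg; rewrite cosft_shift// cosN sinN pi2 -[pi]add0r cosft_shift//.
  by rewrite cospi sinpi dotrC; ring.
have c2 : c * ((2 * pi) ^+ m * c) = 1.
  have s2 : (2 * pi : R) = Num.sqrt (2 * pi) ^+ 2.
    by rewrite sqr_sqrtr// mulr_ge0// pi_ge0.
  have s3 : Num.sqrt (2 * pi) != 0 :> R.
    by rewrite gt_eqF// sqrtr_gt0 mulr_gt0// pi_gt0.
  by rewrite /c {2}s2 -exprM mulnC exprM expr2 mulfK ?expf_neq0// mulVf// expf_neq0.
rewrite /fourier /cintegral /=.
set I1 := Rintegral _ _ _; set I2 := Rintegral _ _ _.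
(* The oscillating factors recombine into phases shifted by [- dotr xi x]. Inversion then gives
   [cos 0] and [cos (pi / 2)], so only one of the two terms survives; likewise for [E2]. *)
have E1 : I1 = (2 * pi) ^+ m * p x.
  transitivity (\int[leb]_xi (cosft (0 - dotr xi x) p xi + cosft (pi / 2 - dotr xi x) q xi)).
    apply: eq_Rintegral => xi _ /=; rewrite s0// s1// cosftN//; ring.
  rewrite RintegralD//; [|exact: integrable_cosft..].
  by rewrite !inversion// cos0 cos_pihalf; ring.
have E2 : I2 = (2 * pi) ^+ m * q x.
  transitivity (\int[leb]_xi (cosft (0 - dotr xi x) q xi - cosft (pi / 2 - dotr xi x) p xi)).
    apply: eq_Rintegral => xi _ /=; rewrite s0// s1// cosftN//; ring.
  rewrite RintegralB//; [|exact: integrable_cosft..].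
  by rewrite !inversion// cos0 cos_pihalf; ring.
rewrite E1 E2 /p /q [_ * (c * complex.Re _)]mulrA [_ * (c * complex.Im _)]mulrA.
case: (phi x) => a b /=; rewrite -/c; congr Complex.
  by rewrite mul0r subr0 mulrA c2 mul1r.
by rewrite mul0r addr0 mulrA c2 mul1r.
Qed.

Lemma schwartz_ctest (phi : schwartz R m) :
  compact (closure [set x | phi x != 0]) -> ctest phi.
Proof.
have /asboolP[/csmoothP sphi _] := schwartz_funP phi.
move=> /compact_bounded[M [Mr MP]].
have phi0 (x : 'rV[R]_m) i : `|M| + 1 < `|x 0 i| -> phi x = 0.
  move=> xi; apply/eqP; apply/negPn/negP => px.
  have := MP (`|M| + 1); rewrite (le_lt_trans (ler_norm _)) ?ltrDl// => /(_ isT x).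
  have cx : closure [set x0 | phi x0 != 0] x by exact: subset_closure.
  move=> /(_ cx) /= xM.
  by move: xi; rewrite ltNge (le_trans (sup_norm_coord x i)).
split; (split => [n|]; first by case: (sphi n));
  by exists (`|M| + 1) => x i /phi0 ->.
Qed.

End schwartz_preimage.

(** * Sobolev spaces and supports *)

Section evaluation.
Context {R : realType} {m : nat}.
Local Notation leb := (@lebesgue_rV R m).

(** Recovers a Cauchy-Schwarz type bound from Young's inequality. The choice [t = 1 / sqrt A] gives
    [1 + B] instead of the optimal [2 sqrt B], but it is linear in [sqrt A], as boundedness of a
    functional requires. *)
Lemma le_sqrt_of_young (x A B : R) : 0 <= A -> 0 <= B ->
  (forall t, 0 < t -> x <= t * A + B / t) -> x <= (1 + B) * Num.sqrt A.
Proof.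
move=> A0 B0 H; have [A00|An0] := eqVneq A 0.
  rewrite A00 sqrtr0 mulr0 leNgt; apply/negP => x0.
  have t0 : 0 < (B + 1) / x by rewrite divr_gt0// ltr_wpDl.
  have := H _ t0; rewrite A00 mulr0 add0r leNgt => /negP; apply; rewrite invf_div mulrA.
  by rewrite ltr_pdivrMr ?ltr_wpDl// mulrC ltr_pM2l// ltrDl.
have s0 : 0 < Num.sqrt A by rewrite sqrtr_gt0 lt_def An0.
have si : 0 < (Num.sqrt A)^-1 by rewrite invr_gt0.
apply: (le_trans (H _ si)); rewrite invrK -{2}(sqr_sqrtr A0) expr2 mulrA mulVf ?gt_eqF//.
by rewrite mulrDl.
Qed.

Lemma measurable_enorm : measurable_fun setT (@enorm R m).
Proof.
apply: (@measurableT_comp _ _ _ _ _ _ (@Num.sqrt R)).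
  by apply: continuous_measurable_fun; exact: sqrt_continuous.
by apply: measurable_sum => i; apply: measurable_funM; exact: measurable_rV_coord.
Qed.

(** The duality of [H^(-1/2)] with [H^(1/2)]: the density [g] of the transform of [u] is paired with
    the Fourier preimage [psi] of [phi], and the weights [w^(-1/2)] and [w^(1/2)] go to [|g|^2] and
    [|psi|^2]. *)
Lemma evaluation_bounded (phi : schwartz R m) : ctest phi -> exists C : R,
  forall u, Hs (- 2^-1) u -> normc (u phi) <= C * Hs_norm (- 2^-1) u.
Proof.
move=> tphi; have [psi psiE] := fourier_preimage tphi.
have /asboolP[/csmoothP spsi dpsi] := schwartz_funP psi.
pose w (x : 'rV[R]_m) := 1 + enorm x ^+ 2.
have w1 x : 1 <= w x by rewrite lerDl sqr_ge0.
have w0 x : 0 < w x by rewrite (lt_le_trans _ (w1 x)).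
have mw : measurable_fun setT w.
  by apply: measurable_funD => //; apply: measurable_funX; exact: measurable_enorm.
have mnc (f : 'rV[R]_m -> R[i]) : measurable_fun setT (fun x => complex.Re (f x)) ->
    measurable_fun setT (fun x => complex.Im (f x)) -> measurable_fun setT (fun x => normc (f x) ^+ 2).
  move=> mR mI; under eq_fun do rewrite sqr_normc.
  by apply: measurable_funD; exact: measurable_funX.
have mpsiR : measurable_fun setT (fun x => complex.Re (psi x)).
  by apply: measurable_rV_continuous; exact: (smooth_continuous (spsi 0%N).1).
have mpsiI : measurable_fun setT (fun x => complex.Im (psi x)).
  by apply: measurable_rV_continuous; exact: (smooth_continuous (spsi 0%N).2).
have mpow r : measurable_fun setT (fun x => w x `^ r).
  by apply: (@measurableT_comp _ _ _ _ _ _ (@powR R ^~ r)) => //; exact: measurable_powR.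
pose b x := w x `^ 2^-1 * normc (psi x) ^+ 2.
have mb : measurable_fun setT b by apply: measurable_funM => //; exact: mnc.
have b0 x : 0 <= b x by rewrite mulr_ge0 ?powR_ge0 ?exprn_ge0 ?normc_ge0.
have ib : leb.-integrable setT (EFin \o b).
  (* One factor [|psi|] is merely bounded by [M0]. The other one absorbs two powers for
     [w^(1/2) <= (1 + e)^2] and [2 * m] powers for [weight]. *)
  have [M0 M0P] := dpsi 0%N [::]; have [M1 M1P] := dpsi (2 + 2 * m)%N [::].
  apply: (@weight_integrable _ _ _ (M0 * M1)) => // x; rewrite ger0_norm//.
  have := M0P x; have := M1P x; rewrite /= expr0 mul1r exprD.
  have := enorm_ge0 x; have := normc_ge0 (psi x).
  have := weight_lower (enorm_ge0 x) (le_coord_enorm x); have := ltW (weight_gt0 x).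
  rewrite /b; set e := enorm x; set n := normc _; set W := weight x.
  set E := (1 + e) ^+ (2 * m) => W0 EW n0 e0 nM1 nM0.
  have M00 : 0 <= M0 by exact: le_trans nM0.
  have wE : w x `^ 2^-1 <= (1 + e) ^+ 2.
    apply: (@le_trans _ _ (w x `^ 1)); first by rewrite ler_powR// invf_le1// ler1n.
    by rewrite powRr1 ?(ltW (w0 x))// /w -/e -subr_ge0 (_ : _ - _ = 2 * e) ?mulr_ge0//; ring.
  apply: (@le_trans _ _ ((1 + e) ^+ 2 * (M0 * n))).
    by apply: ler_pM; rewrite ?powR_ge0 ?exprn_ge0// expr2 ler_wpM2r.
  rewrite mulrCA -mulrA ler_wpM2l//.
  apply: (@le_trans _ _ ((1 + e) ^+ 2 * n * (E * W))).
    by rewrite ler_peMr// mulr_ge0// exprn_ge0// addr_ge0.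
  rewrite (_ : _ * (E * W) = ((1 + e) ^+ 2 * E * n) * W); last by ring.
  by rewrite ler_wpM2r.
exists (1 + \int[leb]_x b x) => u [tu eg nu].
have [lg Hg] := xgetPex (cst 0) eg.
rewrite -/(fourier_density u) in lg Hg; set g := fourier_density u in lg Hg.
have [mgR mgI _] := lg.
have -> : u phi = cintegral (g \* psi).
  (* As [fourier psi] is [phi], a Schwartz function, [insubd] returns [phi] and not its default. *)
  rewrite -(Hg psi).2 /dfourier; congr u; rewrite psiE; exact/esym/valKd.
have [[iR iI] _] := Hg psi.
pose a x := w x `^ (- 2^-1) * normc (g x) ^+ 2.
have a0 x : 0 <= a x by rewrite mulr_ge0 ?powR_ge0 ?exprn_ge0 ?normc_ge0.
have ma : measurable_fun setT a by apply: measurable_funM => //; exact: mnc.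
have ia : leb.-integrable setT (EFin \o a).
  apply/integrableP; split; first exact/measurable_EFinP.
  by under eq_integral do rewrite /= ger0_norm//.
have -> : Hs_norm (- 2^-1) u = Num.sqrt (\int[leb]_x a x) by [].
apply: le_sqrt_of_young; [exact: Rintegral_ge0..|] => t t0.
(* The difference is a multiple of the square of [G - be / t * P]. The factor 1/2 leaves room for
   bounding the real and the imaginary part separately, after which the two bounds are added. *)
have young x : normc (g x * psi x) <= 2^-1 * (t * a x + t^-1 * b x).
  rewrite normcM /a /b powRN.
  have be0 : 0 < w x `^ 2^-1 by rewrite powR_gt0.
  set be := w x `^ 2^-1 in be0 *; set G := normc (g x); set P := normc (psi x).
  rewrite -subr_ge0 (_ : _ - _ = 2^-1 * (t / be) * (G - be / t * P) ^+ 2).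
    by rewrite mulr_ge0 ?sqr_ge0// mulr_ge0// divr_ge0// ltW.
  by field; rewrite !gt_eqF.
have iab : leb.-integrable setT (EFin \o (fun x => 2^-1 * (t * a x + t^-1 * b x))).
  by apply: integrableZ; apply: integrable_add; exact: integrableZ.
apply: (le_trans (le_normc _)).
have -> : t * \int[leb]_x a x + (\int[leb]_x b x) / t =
    \int[leb]_x (2^-1 * (t * a x + t^-1 * b x)) + \int[leb]_x (2^-1 * (t * a x + t^-1 * b x)).
  rewrite RintegralZ; last by apply: integrable_add; exact: integrableZ.
  rewrite RintegralD//; [|exact: integrableZ..].
  rewrite !RintegralZ//; set IA := Rintegral _ _ _; set IB := Rintegral _ _ _.
  by field; rewrite gt_eqF.
apply: lerD; apply: le_norm_Rintegral => //.
- exact: integrable_measurable iR.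
- by move=> x; apply: le_trans (young x); exact: le_Re_normc.
- exact: integrable_measurable iI.
- by move=> x; apply: le_trans (young x); exact: le_Im_normc.
Qed.

End evaluation.

(** * The du Bois-Reymond lemma *)

Section du_bois_reymond.
Context {R : realType} {m : nat}.
Local Notation leb := (@lebesgue_rV R m).
Implicit Types (a b x : 'rV[R]_m) (g : 'rV[R]_m -> R).

Definition open_box a b : set 'rV[R]_m := [set x | forall i, a 0 i < x 0 i < b 0 i].

Lemma open_box_bigcap a b : open_box a b =
  \bigcap_(i in [set: 'I_m]) (rV_coord i @^-1` `](a 0 i), (b 0 i)[%classic).
Proof.
apply/seteqP; split => x /= xab; last by move=> i; have := xab i I; rewrite /rV_coord/= in_itv.
by move=> i _; rewrite /rV_coord/= in_itv/=.
Qed.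

Lemma measurable_open_box a b : measurable (open_box a b).
Proof.
rewrite open_box_bigcap; apply: fin_bigcap_measurable; first exact: finite_finset.
move=> i _; rewrite -[X in measurable X]setTI; apply: measurable_rV_coord => //.
Qed.

Definition boxes : set (set 'rV[R]_m) := [set A | exists a b, A = open_box a b].

Lemma boxes_setI : setI_closed boxes.
Proof.
move=> _ _ [a [b ->]] [c [d ->]].
exists (\row_i Num.max (a 0 i) (c 0 i)), (\row_i Num.min (b 0 i) (d 0 i)).
apply/seteqP; split => x /=.
  move=> [h1 h2] i; rewrite !mxE gt_max lt_min.
  by have /andP[-> ->] := h1 i; have /andP[-> ->] := h2 i.
move=> h; split => i; have := h i; rewrite !mxE gt_max lt_min => /andP[/andP[h1 h2] /andP[h3 h4]].
  by rewrite h1 h3.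
by rewrite h2 h4.
Qed.

Let cube (k : nat) := open_box (const_mx (- k%:R)) (const_mx k%:R).

Lemma mem_cube x : exists k, cube k x.
Proof.
have [k kx] : exists k : nat, `|x| < k%:R.
  by exists (Num.bound `|x|); apply: (le_lt_trans _ (archi_boundP _)).
exists k => i; rewrite !mxE -ltr_norml; exact: le_lt_trans (sup_norm_coord x i) kx.
Qed.

(** A slab [c < x_i < d] is the union over [k] of the boxes whose other coordinates range over []-k,
    k[]. *)
Lemma measurable_boxes : @measurable _ 'rV[R]_m = <<s boxes >>.
Proof.
apply/seteqP; split; last first.
  apply: smallest_sub; first exact: sigma_algebra_measurable.
  by move=> _ [a [b ->]]; exact: measurable_open_box.
apply: smallest_sub; first exact: smallest_sigma_algebra.
rewrite -bigcup_seq => A [i _] [B mB <-].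
suff : measurable_fun setT (@rV_coord R m i : g_sigma_algebraType boxes -> R) by move=> /(_ measurableT B mB).
apply: (measurability _ (RGenOpens.measurableE R)) => _ [_ [c [d ->]] <-]; rewrite setTI.
rewrite (_ : _ @^-1` _ = \bigcup_k open_box
    (\row_j if j == i then c else - k%:R) (\row_j if j == i then d else k%:R)).
  by apply: bigcupT_measurable => k; apply: sub_sigma_algebra; do 2 eexists.
apply/seteqP; split => x.
  rewrite /rV_coord/= in_itv/= => xi; have [k kx] := mem_cube x.
  exists k => // j; rewrite !mxE; case: eqP => [->//|_].
  by have := kx j; rewrite !mxE.
move=> [k _] /(_ i); rewrite !mxE eqxx => xi.
by rewrite /rV_coord/= in_itv.
Qed.

(** Test functions bounded by 1 that vanish off the open box and tend to 1 at each of its points: a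
    dominated approximation of its indicator. *)
Let bump (n : nat) a b x : R :=
  \prod_(i < m) (flat (n.+1%:R * (x 0 i - a 0 i)) * flat (n.+1%:R * (b 0 i - x 0 i))).

Let bump_outside n a b x i : ~~ (a 0 i < x 0 i < b 0 i) -> bump n a b x = 0.
Proof.
rewrite negb_and -!leNgt => h; rewrite /bump (bigD1 i)//=.
case/orP : h => h.
  by rewrite (@flat_le0 _ (_ * (x 0 i - _))) ?mul0r// mulr_ge0_le0// subr_le0.
by rewrite (@flat_le0 _ (_ * (b 0 i - _))) ?mulr0 ?mul0r// mulr_ge0_le0// subr_le0.
Qed.

Let bump_norm_le1 n a b x : `|bump n a b x| <= 1.
Proof.
have p1 : \prod_(i < m) (1 : R) = 1 by rewrite big1_eq.
rewrite /bump normr_prod -[leRHS]p1.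
apply: ler_prod => i _; rewrite normr_ge0/= normrM -[leRHS]mulr1.
by apply: ler_pM => //; rewrite ger0_norm ?flat_ge0// flat_le1.
Qed.

Let cvg_bump a b x : open_box a b x -> bump n a b x @[n --> \oo] --> (1 : R).
Proof.
have p1 : \prod_(i < m) (1 : R) = 1 by rewrite big1_eq.
move=> xab; rewrite -[X in _ --> X]p1.
apply: cvg_big => [|i _]; first exact: mul_continuous.
have /andP[ai bi] := xab i.
by rewrite -[X in _ --> X]mulr1; apply: cvgM; apply: cvg_flat; rewrite subr_gt0.
Qed.

Let bump_test n a b : test_function (bump n a b).
Proof.
split => [k|].
  apply: (@smooth_prod _ _ _ _ _ (fun i x => flat _ * flat _)) => i.
  have smooth_affine (c d : R) : smooth k (fun x : 'rV[R]_m => flat (c * x 0 i + d)).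
    rewrite (_ : (fun _ => _) = (fun x => (fun t => flat (c * t + d)) (dotr 'e_i x))).
      apply: (@smooth_ridge _ m k (fun t => flat (c * t + d))).
      by apply: (@smooth1_comp _ k flat); [exact: smooth1_flat|exact: smooth1_affine].
    by apply/funext => x; rewrite dotrC dotr_e.
  apply: smooth_mul.
    rewrite (_ : (fun _ => _) = (fun x => flat (n.+1%:R * x 0 i + n.+1%:R * - a 0 i))) //.
    by apply/funext => x; rewrite -mulrDr.
  rewrite (_ : (fun _ => _) = (fun x => flat (- n.+1%:R * x 0 i + n.+1%:R * b 0 i))) //.
  by apply/funext => x; congr flat; ring.
exists (`|a| + `|b|) => x i xL; apply: (@bump_outside _ _ _ _ i).
apply/negP => /andP[ai bi]; move: xL; apply/negP; rewrite -leNgt ler_norml.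
have := sup_norm_coord a i; have := sup_norm_coord b i.
rewrite !ler_norml => /andP[b1 b2] /andP[a1 a2].
have := normr_ge0 a; have := normr_ge0 b => b0 a0.
by apply/andP; split; lra.
Qed.

Context (g : 'rV[R]_m -> R) (mg : measurable_fun setT g)
  (ig : forall K, compact K -> leb.-integrable K (EFin \o g))
  (g0 : forall h, test_function h -> \int[leb]_x (g x * h x) = 0).

Let integrable_open_box a b : leb.-integrable (open_box a b) (EFin \o g).
Proof.
pose K := [set v : 'rV[R]_m | forall i, `[a 0 i, b 0 i]%classic (v 0 i)].
have cK : compact K.
  apply: (@rV_compact _ _ (fun i => `[a 0 i, b 0 i]%classic)) => i; exact: segment_compact.
have mK : measurable K.
  rewrite (_ : K = \bigcap_(i in [set: 'I_m]) (rV_coord i @^-1` `[a 0 i, b 0 i]%classic)).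
    apply: fin_bigcap_measurable; first exact: finite_finset.
    by move=> i _; rewrite -[X in measurable X]setTI; exact: measurable_rV_coord.
  by apply/seteqP; split => [v Kv i _|v Kv i]; [exact: Kv|exact: (Kv i I)].
apply: (integrableS mK (measurable_open_box a b) _ (ig cK)) => x xab i /=.
by rewrite in_itv/=; have /andP[/ltW -> /ltW ->] := xab i.
Qed.

Let integral_open_box a b : (\int[leb]_(x in open_box a b) (g x)%:E = 0)%E.
Proof.
have mB := measurable_open_box a b.
have iB := integrable_open_box a b.
rewrite -[LHS]fineK; last exact: (integrable_fin_num mB iB).
rewrite -/(Rintegral leb (open_box a b) g); congr EFin.
have lim1 : \int[leb]_(x in open_box a b) (g x * bump n a b x) @[n --> \oo] -->
    \int[leb]_(x in open_box a b) g x.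
  have mgB : measurable_fun (open_box a b) g by exact: measurable_funTS.
  apply: (cvg_Rintegral _ _ _ (integrable_norm iB)) => //.
  - by move=> n; apply: measurable_funM => //; apply: measurable_funTS;
      exact: test_measurable (bump_test n a b).
  - by move=> n x _; rewrite normrM ler_piMr ?bump_norm_le1.
  - move=> x xab; rewrite -[X in _ --> X]mulr1; apply: cvgM; first exact: cvg_cst.
    exact: cvg_bump.
have eq0 n : \int[leb]_(x in open_box a b) (g x * bump n a b x) = 0.
  rewrite -[RHS](g0 (bump_test n a b)) Rintegral_mkcond; apply: eq_Rintegral => x _.
  rewrite patchE; case: ifPn => //; rewrite notin_setE => /existsNP[k /negP xk].
  by rewrite (bump_outside _ xk) mulr0.
move: lim1; under eq_fun do rewrite eq0.
have lim0 : (fun=> 0 : R) n @[n --> \oo] --> (0 : R) by exact: cvg_cst.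
by move=> lim1; exact: (cvg_unique _ lim1 lim0).
Qed.

(** The integral of [g] vanishes on every box, hence by Dynkin's theorem on every measurable part of
    a cube, hence [g = 0] almost everywhere there. Working inside cubes is what local integrability
    permits; countably many of them exhaust the space. *)
Lemma du_bois_reymond : {ae leb, forall x, g x = 0}.
Proof.
have cube_ae k : ae_eq leb (cube k) (cst 0%E) (EFin \o g).
  have mQ := measurable_open_box (const_mx (- k%:R)) (const_mx k%:R) : measurable (cube k).
  have iQ := integrable_open_box (const_mx (- k%:R)) (const_mx k%:R).
  have mgQ A : measurable A -> measurable_fun A (EFin \o g).
    by move=> mA; apply/measurable_EFinP; exact: measurable_funTS.
  apply: integral_ae_eq => //; first exact: integrable0.
    exact: mgQ.
  have H : forall S, <<s boxes >> S -> (\int[leb]_(x in S `&` cube k) (g x)%:E = 0)%E.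
    apply: dynkin_induction.
    - exact: measurable_boxes.
    - exact: boxes_setI.
    - by rewrite setTI integral_open_box.
    - move=> A bA; have bc : boxes (cube k) by do 2 eexists.
      by have [c [d ->]] := boxes_setI bA bc; exact: integral_open_box.
    - move=> S mS S0; have := integral_open_box (const_mx (- k%:R)) (const_mx k%:R).
      rewrite -/(cube k) -{1}(setTI (cube k)) -(setUv S) setIUl integral_setU.
      + by rewrite S0 add0e.
      + exact: measurableI.
      + by apply: measurableI => //; exact: measurableC.
      + apply: mgQ; apply: measurableU; apply: measurableI => //; exact: measurableC.
      + by apply/disj_setPS => x [[Sx _] [nSx _]].
    - move=> F mF tF F0; rewrite setI_bigcupl integral_bigcup.
      + by rewrite eseries0// => i _ _; exact: F0.
      + exact: trivIset_setIr.
      + by move=> n; exact: measurableI.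
      + rewrite -setI_bigcupl; apply: (integrableS mQ _ _ iQ) => //.
        by apply: measurableI => //; exact: bigcup_measurable.
  move=> E EQ mE; rewrite integral0 -(H E) ?(setIidl EQ)//.
  by rewrite -measurable_boxes.
have := ae_foralln cube_ae; apply: filterS => x h.
by have [k /h []] := mem_cube x.
Qed.

End du_bois_reymond.

(** * The norm of zero, and localisation by cut-offs *)

Section locality.
Context {R : realType} {m : nat}.
Local Notation leb := (@lebesgue_rV R m).
Local Notation S := (schwartz R m).
Implicit Types (f : 'rV[R]_m -> R[i]) (h : 'rV[R]_m -> R).

Lemma ctest_partial i f : ctest f -> ctest (cpartial i f).
Proof. by move=> [t1 t2]; split; exact: test_partial. Qed.

Lemma ctest_schwartz f : ctest f -> is_schwartz f.
Proof.
move=> tf; split; first by apply/csmoothP => n; split; [exact: tf.1.1|exact: tf.2.1].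
move=> k a.
have decay h : test_function h -> exists M, forall x, (1 + enorm x) ^+ k * `|h x| <= M.
  move=> [sh [L hL]].
  have [M MP] := test_bounded (smooth_continuous (sh 0%N)) (ex_intro _ L hL).
  exists ((1 + m%:R * `|L|) ^+ k * M) => x.
  have M0 : 0 <= M by exact: le_trans (MP x).
  have [/forallP xL|] := boolP [forall j, `|x 0 j| <= L]; last first.
    rewrite negb_forall => /existsP[j]; rewrite -ltNge => /hL ->.
    by rewrite normr0 mulr0 mulr_ge0// exprn_ge0// addr_ge0// mulr_ge0.
  apply: ler_pM => //; first by rewrite exprn_ge0// addr_ge0// enorm_ge0.
  rewrite lerXn2r ?nnegrE ?addr_ge0 ?enorm_ge0 ?mulr_ge0// lerD2l.
  apply: (le_trans (le_enorm x)).
  rewrite mulr_natl -[X in _ *+ X](card_ord m) -sumr_const; apply: ler_sum => j _.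
  exact: le_trans (xL j) (ler_norm _).
have {tf} [tR tI] : ctest (cpartials a f) by elim: a => //= i a; exact: ctest_partial.
have [M MP] := decay _ tR; have [N NP] := decay _ tI.
exists (M + N) => x; apply: le_trans (lerD (MP x) (NP x)).
by rewrite -mulrDr ler_wpM2l ?exprn_ge0 ?addr_ge0 ?enorm_ge0// le_normc.
Qed.

(* [fourier_density 0] is only chosen among the densities of [0]; that it vanishes
   almost everywhere is the du Bois-Reymond lemma. *)
Lemma Hs_norm0 s : Hs_norm s (0 : S -> R[i]) = 0.
Proof.
rewrite /Hs_norm (_ : Hs_sqnorm s 0 = 0%E) ?sqrtr0//.
rewrite /Hs_sqnorm; set g := fourier_density 0.
have [mR [mI [aR aI]]] : measurable_fun setT (fun x => complex.Re (g x)) /\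
    measurable_fun setT (fun x => complex.Im (g x)) /\
    {ae leb, forall x, complex.Re (g x) = 0} /\ {ae leb, forall x, complex.Im (g x) = 0}.
  (* If the zero distribution had no density, the default [cst 0] would be chosen; otherwise the
     chosen density integrates to 0 against every test function. *)
  have [ex|nex] := pselect (exists g, has_density (dfourier (0 : S -> R[i])) g); last first.
    have -> : g = cst 0 by rewrite /g /fourier_density xgetPN// => g' hg'; apply: nex; exists g'.
    by do 3 ?split; rewrite //=; apply: aeW.
  have [[mR mI ig] H] := xgetPex (cst 0) ex; rewrite -/g in mR mI ig H.
  have H0 h : test_function h -> \int[leb]_x (complex.Re (g x) * h x) = 0 /\
      \int[leb]_x (complex.Im (g x) * h x) = 0.
    (* A real test function, taken as a complex one, separates the real and imaginary parts of
       [g]. *)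
    move=> th; pose phi x : R[i] := h x +i* 0.
    have tphi : ctest phi.
      split => //; split => [n|]; first exact: smooth_cst.
      by exists 0.
    have [_] := H (Schwartz (asboolT (ctest_schwartz tphi))).
    rewrite /dfourier /= => /esym E; split.
      transitivity (complex.Re (cintegral (g \* phi))); last by rewrite E.
      by apply: eq_Rintegral => x _ /=; case: (g x) => a b /=; ring.
    transitivity (complex.Im (cintegral (g \* phi))); last by rewrite E.
    by apply: eq_Rintegral => x _ /=; case: (g x) => a b /=; ring.
  do 3 (split => //); apply: du_bois_reymond => //.
  - by move=> K /ig[].
  - by move=> h /H0[].
  - by move=> K /ig[].
  - by move=> h /H0[].
rewrite -(integral0 leb setT); apply: ae_eq_integral => //.
  apply/measurable_EFinP; apply: measurable_funM.
    apply: (@measurableT_comp _ _ _ _ _ _ (@powR R ^~ s)); first exact: measurable_powR.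
    by apply: measurable_funD => //; apply: measurable_funX; exact: measurable_enorm.
  by under eq_fun do rewrite sqr_normc; apply: measurable_funD; exact: measurable_funX.
apply: filterS2 aR aI => x h1 h2 _.
by rewrite sqr_normc h1 h2 expr0n/= addr0 mulr0.
Qed.

(** The shift by 2 places the transition of each [plateau] between the distances [r] and [2 * r]
    from [x]. *)
Definition cutoff (x : 'rV[R]_m) (r : R) (y : 'rV[R]_m) : R :=
  \prod_(i < m) (plateau (r^-1 * (y 0 i - x 0 i) + 2) * plateau (r^-1 * (x 0 i - y 0 i) + 2)).

Lemma smooth_cutoff n x r : smooth n (cutoff x r).
Proof.
apply: (@smooth_prod _ _ _ _ _ (fun i y => plateau _ * plateau _)) => i.
have sa (c d : R) : smooth n (fun y : 'rV[R]_m => plateau (c * y 0 i + d)).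
  rewrite (_ : (fun _ => _) = (fun y => (fun t => plateau (c * t + d)) (dotr 'e_i y))).
    apply: (@smooth_ridge _ m n (fun t => plateau (c * t + d))).
    by apply: (@smooth1_comp _ n plateau); [exact: smooth1_plateau|exact: smooth1_affine].
  by apply/funext => y; rewrite dotrC dotr_e.
apply: smooth_mul.
  rewrite (_ : (fun _ => _) = (fun y : 'rV[R]_m => plateau (r^-1 * y 0 i + (- r^-1 * x 0 i + 2)))) //.
  by apply/funext => y; congr plateau; ring.
rewrite (_ : (fun _ => _) = (fun y : 'rV[R]_m => plateau (- r^-1 * y 0 i + (r^-1 * x 0 i + 2)))) //.
by apply/funext => y; congr plateau; ring.
Qed.

Lemma cutoff1 (x : 'rV[R]_m) (r : R) (y : 'rV[R]_m) : 0 < r ->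
  (forall i, `|y 0 i - x 0 i| <= r) -> cutoff x r y = 1.
Proof.
move=> r0 yx; rewrite /cutoff big1// => i _; have := yx i.
rewrite ler_norml => /andP[h1 h2].
have k t : - r <= t -> 1 <= r^-1 * t + 2.
  by move=> rt; rewrite mulrC -lerBlDr (_ : 1 - 2 = - r / r) ?ler_pM2r ?invr_gt0// mulNr divff ?gt_eqF//; ring.
rewrite !plateau_ge1 ?mulr1// k// -opprB lerN2//.
Qed.

Lemma cutoff0 (x : 'rV[R]_m) (r : R) (y : 'rV[R]_m) i : 0 < r ->
  2 * r <= `|y 0 i - x 0 i| -> cutoff x r y = 0.
Proof.
move=> r0 yx; rewrite /cutoff (bigD1 i)//=.
have k t : t <= - (2 * r) -> r^-1 * t + 2 <= 0.
  move=> rt; rewrite mulrC -lerBrDr sub0r ler_pdivrMr//; lra.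
move: yx; rewrite ler_normr => /orP[h|h].
  by rewrite (@plateau_le0 _ (_ * (x 0 i - _) + _)) ?mulr0 ?mul0r// k// -opprB lerN2.
by rewrite (@plateau_le0 _ (_ * (y 0 i - _) + _)) ?mul0r// k// -lerN2 opprK.
Qed.

(** The support is defined through the union of all open sets on which [u] vanishes; that [u]
    vanishes on the union itself is a gluing statement, proved by compactness and finitely many
    cut-offs. *)
Lemma dsupp_vanishes (u : S -> R[i]) : scalar u ->
  forall phi : S, compact (closure [set x | phi x != 0]) ->
  closure [set x | phi x != 0] `<=` ~` dsupp u -> u phi = 0.
Proof.
move=> lu phi cphi sphi; set K := closure _ in cphi sphi.
pose C2 (x : 'rV[R]_m) (r : R) := [set y : 'rV[R]_m | forall i, `|y 0 i - x 0 i| <= 2 * r].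
have C2E x r : C2 x r = [set v : 'rV[R]_m | forall i, `[x 0 i - 2 * r, x 0 i + 2 * r]%classic (v 0 i)].
  by apply/seteqP; split => y h i; have := h i; rewrite /= in_itv/= ler_distl.
have cC2 x r : compact (C2 x r).
  rewrite C2E; apply: (@rV_compact _ _ (fun i => `[x 0 i - 2 * r, x 0 i + 2 * r]%classic)) => i.
  exact: segment_compact.
pose good x r := exists U, [/\ open U, vanishes_on u U & C2 x r `<=` U].
have /choice[r rP] x : exists r : R, 0 < r /\ (K x -> good x r).
  have [Kx|nKx] := pselect (K x); last by exists 1.
  have := sphi _ Kx; rewrite /dsupp setCK => -[U [oU vU] Ux].
  have /nbhs_ballP[e /= e0 eU] : nbhs x U by exact: open_nbhs_nbhs.
  (* The closed cube of radius [2 * e / 3], which contains the support of the cut-off, still fits in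
     the ball of radius [e]. *)
  exists (e / 3); split; first by rewrite divr_gt0.
  move=> _; exists U; split => // y yx; apply: eU; apply: rV_ball => // i.
  by rewrite distrC (le_lt_trans (yx i))//; lra.
(* The cut-offs are peeled off one at a time: [psi = chi psi + (1 - chi) psi]. The first summand is
   supported where [u] vanishes; the second is zero on the cube of radius [r x], so the remaining
   cubes cover it. The covering condition bears on the points with [psi y != 0], without closure, so
   that it survives this multiplication. *)
have key (l : seq 'rV[R]_m) : forall psi : S, ctest psi -> (forall x, x \in l -> good x (r x)) ->
    (forall y, psi y != 0 -> exists2 x, x \in l & forall i, `|y 0 i - x 0 i| <= r x) -> u psi = 0.
  elim: l => [|x l IH] psi tpsi gl cover.
    have -> : psi = 0.
      by apply/val_inj/funext => y /=; apply/eqP/negPn/negP => /cover[].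
    have := lu 1 0 0; rewrite scaler0 addr0 mul1r => /eqP.
    by rewrite -subr_eq subrr eq_sym => /eqP.
  have mulc (f : 'rV[R]_m -> R) : (forall n, smooth n f) -> ctest (fun y => (f y)%:C * psi y).
    move=> sf; split.
      rewrite (_ : (fun y => _) = (fun y => f y * complex.Re (psi y))); first exact: test_mul tpsi.1.
      by apply/funext => y; case: (psi y) => a b /=; ring.
    rewrite (_ : (fun y => _) = (fun y => f y * complex.Im (psi y))); first exact: test_mul tpsi.2.
    by apply/funext => y; case: (psi y) => a b /=; ring.
  have t1 := mulc _ (fun n => smooth_cutoff n x (r x)).
  have t2 := mulc (fun y => 1 - cutoff x (r x) y)
    (fun n => smooth_sub (smooth_cst _ n 1) (smooth_cutoff n x (r x))).
  pose psi1 : S := Schwartz (asboolT (ctest_schwartz t1)).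
  pose psi2 : S := Schwartz (asboolT (ctest_schwartz t2)).
  have -> : psi = 1 *: psi1 + psi2.
    apply/val_inj/funext => y /=; rewrite scale1r /= !fctE /=.
    rewrite -mulrDl; case: (psi y) => a b; apply/eqP; rewrite eq_complex/=; apply/andP; split; apply/eqP; ring.
  rewrite lu (IH psi2)//.
  - rewrite addr0 mul1r.
    have [U [oU vU C2U]] : good x (r x) by apply: gl; rewrite mem_head.
    have sub : closure [set y | psi1 y != 0] `<=` C2 x (r x).
      rewrite [X in _ `<=` X](closure_id _).1; last exact: compact_closed.
      apply: closure_subset => y /= py i; rewrite leNgt; apply/negP => /ltW yi.
      by move: py; rewrite (cutoff0 (rP x).1 yi) mul0r eqxx.
    apply: vU; last exact: subset_trans sub C2U.
    by apply: (subclosed_compact _ (cC2 x (r x)) sub); exact: closed_closure.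
  - by move=> z zl; apply: gl; rewrite in_cons zl orbT.
  move=> y; rewrite /psi2/= => py.
  have : psi y != 0 by apply: contraNneq py => ->; rewrite mulr0.
  move=> /cover[z]; rewrite in_cons => /orP[/eqP ->|zl zy]; last by exists z.
  by move=> yx; move: py; rewrite cutoff1// ?subrr ?mul0r ?eqxx//; exact: (rP x).1.
have := cphi; rewrite compact_cover => /(_ _ K (fun x => ball x (r x)))[||D DK cov].
- by move=> x _; apply: ball_open; exact: (rP x).1.
- by move=> x Kx; exists x => //; apply: ballxx; exact: (rP x).1.
apply: (key (finmap.enum_fset D)) => [|x xD|y py].
- exact: schwartz_ctest.
- by apply: (rP x).2; have := DK x xD; rewrite inE.
have Ky : K y by exact: subset_closure.
have [x xD [_ xy]] := cov y Ky.
exists x => // i; have := xy 0 i.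
by rewrite -ball_normE/= distrC => /ltW.
Qed.

End locality.

(** * Mosco convergence for decreasing sets *)

Section mosco_of_nested.
Context {R : realType} {m : nat}.
Local Notation S := (schwartz R m).

Lemma bvp_cvg_nested (G_ : nat -> set 'rV[R]_m) (G : set 'rV[R]_m) :
  (forall j, closed (G_ j)) -> (forall j, G_ j.+1 `<=` G_ j) ->
  G = \bigcap_j G_ j -> bvp_cvg G_ G.
Proof.
move=> cG dG GE.
have mono j k : (j <= k)%N -> G_ k `<=` G_ j.
  elim: k => [|k IH]; first by rewrite leqn0 => /eqP ->.
  by rewrite leq_eqVlt => /orP[/eqP ->//|/IH]; exact: subset_trans.
split.
  move=> w [Hw sw]; exists (fun=> w); split => [j|].
    by split => //; apply: (subset_trans sw); rewrite GE; exact: bigcap_inf.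
  by rewrite subrr Hs_norm0; exact: cvg_cst.
move=> j_ w_ w hj Ww Hw weak; split => //.
have jge k : (k <= j_ k)%N.
  by elim: k => // k IH; rewrite (leq_ltn_trans IH)// hj.
move=> x; rewrite /dsupp GE => nx j _; apply: contrapT => xj; apply: nx.
exists (~` G_ j) => //=; split; first exact/closed_openC/cG.
move=> phi cphi sphi.
have [C CP] := evaluation_bounded (schwartz_ctest cphi).
have := weak (fun u => u phi) _.
have lin : bounded_functional (Hs (- 2^-1)) (Hs_norm (- 2^-1)) (fun u : S -> R[i] => u phi).
  by split => //; exists C.
move=> /(_ lin) lim1.
have lim0 : normc (w_ k phi - w phi) @[k --> \oo] --> normc (w phi).
  apply: cvg_near_cst; near=> k.
  have [[[lw _] _ _] sw] := Ww k.
  rewrite (dsupp_vanishes lw cphi) ?sub0r ?normcN//.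
  apply: (subset_trans sphi); apply: subsetC; apply: (subset_trans sw).
  apply: mono; apply: leq_trans (jge k).
  by near: k; exact: nbhs_infty_ge.
exact/eq0_normc/(cvg_unique _ lim0 lim1).
Unshelve. all: by end_near. Qed.

End mosco_of_nested.

(** * The attractor as a nested intersection *)

Section attractor.
Context {R : realType} {m nu : nat}.
Implicit Types (s : 'I_nu -> 'rV[R]_m -> 'rV[R]_m).

Lemma le_norm_enorm (x : 'rV[R]_m) : `|x| <= enorm x.
Proof.
rewrite /Num.norm/= mx_normrE; apply: bigmax_le => [|[i j] _]; first exact: enorm_ge0.
by rewrite ord1; exact: le_coord_enorm.
Qed.

(** Contractions are measured in the Euclidean norm, continuity in the sup norm; passing from one to
    the other costs the factor [m]. *)
Lemma contraction_continuous (f : 'rV[R]_m -> 'rV[R]_m) : contraction_map f -> continuous f.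
Proof.
move=> [c [c0 c1 fc]]; apply: (@lipschitz_continuous _ _ _ f m%:R) => x y.
apply: (le_trans (le_norm_enorm _)); apply: (le_trans (fc x y)).
apply: (@le_trans _ _ (enorm (x - y))); first by rewrite ler_piMl ?enorm_ge0// ltW.
apply: (le_trans (le_enorm _)).
rewrite mulr_natl -[X in _ *+ X](card_ord m) -sumr_const; apply: ler_sum => j _.
exact: sup_norm_coord.
Qed.

(** Pick a point in each set. The sequence has a cluster point in [A_ 0], and each closed [A_ j]
    contains a tail of the sequence, hence the cluster point. *)
Lemma nested_compact (T : topologicalType) (A_ : nat -> set T) :
  compact (A_ 0%N) -> (forall j, closed (A_ j)) -> (forall j, A_ j.+1 `<=` A_ j) ->
  (forall j, A_ j !=set0) -> \bigcap_j A_ j !=set0.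
Proof.
move=> cA clA dA /choice[x xA].
have mono j k : (j <= k)%N -> A_ k `<=` A_ j.
  elim: k => [|k IH]; first by rewrite leqn0 => /eqP ->.
  by rewrite leq_eqVlt => /orP[/eqP ->//|/IH]; exact: subset_trans.
have ev j : (x k @[k --> \oo]) (A_ j).
  by exists j => // k /= jk; apply: (mono _ _ jk); exact: xA.
have [p [_ px]] := cA (x k @[k --> \oo]) _ (ev 0%N).
exists p => j _; have -> : A_ j = closure (A_ j) by exact/closure_id.
move=> B Bp.
by have := px _ _ (ev j) Bp.
Qed.

Lemma ifs_image_mono s (U V : set 'rV[R]_m) : U `<=` V -> ifs_image s U `<=` ifs_image s V.
Proof. by move=> UV _ [k kT [x Ux <-]]; exists k => //; exists x => //; exact: UV. Qed.

Lemma ifs_image_compact s (U : set 'rV[R]_m) : (forall k, continuous (s k)) ->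
  compact U -> compact (ifs_image s U).
Proof.
move=> cs cU; rewrite /ifs_image (_ : \bigcup_(k in _) _ = \big[setU/set0]_(k < nu) (s k @` U)).
  apply: bigsetU_compact => k _; apply: continuous_compact => //.
  exact: continuous_subspaceT.
rewrite -bigcup_seq (_ : [set` index_enum _] = setT)//.
by apply/seteqP; split => k //= _; exact: mem_index_enum.
Qed.

(** By uniqueness of the attractor it suffices that the intersection is a non-empty compact fixed
    point. An image of an intersection may be smaller than the intersection of the images;
    compactness is what gives equality here. *)
Lemma attractor_bigcap s (G : set 'rV[R]_m) (G_ : nat -> set 'rV[R]_m) :
  (0 < nu)%N -> (forall k, continuous (s k)) -> is_attractor s G ->
  G_ 0%N !=set0 -> compact (G_ 0%N) -> ifs_image s (G_ 0%N) `<=` G_ 0%N ->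
  (forall j, G_ j.+1 = ifs_image s (G_ j)) ->
  [/\ forall j, closed (G_ j), forall j, G_ j.+1 `<=` G_ j & G = \bigcap_j G_ j].
Proof.
move=> nu_gt0 cs [_ _ _ uniq] n0 c0 s0 GS.
have hausd : hausdorff_space 'rV[R]_m by exact: norm_hausdorff.
have cG j : compact (G_ j) by elim: j => // j IH; rewrite GS; exact: ifs_image_compact.
have clG j : closed (G_ j) by apply: compact_closed.
have dG j : G_ j.+1 `<=` G_ j.
  by elim: j => [|j IH]; [rewrite GS|rewrite (GS j.+1) [X in _ `<=` X](GS j); exact: ifs_image_mono].
pose nu0 := Ordinal nu_gt0.
have nG j : G_ j !=set0.
  elim: j => // j [x xj]; by exists (s nu0 x); rewrite GS; exists nu0 => //; exists x.
split => //; apply/esym/uniq.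
- exact: nested_compact.
- apply: (subclosed_compact _ c0); first by apply: closed_bigI => j _; exact: clG.
  exact: bigcap_inf.
(* The image of the intersection lies in [G_ 0] by the hypothesis on [G_ 0], and in [G_ j.+1] by the
   recursion. *)
apply/seteqP; split => [y yK|_ [k _ [x xK <-]] [_|j _]]; last 2 first.
- by apply: s0; exists k => //; exists x => //; exact: xK.
- by rewrite GS; exists k => //; exists x => //; exact: xK.
have cl1 : closed [set y] by apply: compact_closed => //; exact: compact_set1.
(* The preimages of [y] inside [G_ j]. They are compact and decreasing, and non-empty because [y]
   lies in [G_ j.+1], the image of [G_ j]; a common point is a preimage of [y] in the
   intersection. *)
pose B j := G_ j `&` \bigcup_(k in [set: 'I_nu]) (s k @^-1` [set y]).
have [||||x xB] := @nested_compact _ B.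
- apply: compact_closedI => //; apply: closed_bigcup; first exact: finite_finset.
  move=> k _; apply: closed_comp; first by move=> ? _; exact: cs.
  exact: cl1.
- move=> j; apply: closedI => //; apply: closed_bigcup; first exact: finite_finset.
  move=> k _; apply: closed_comp; first by move=> ? _; exact: cs.
  exact: cl1.
- by move=> j; apply: setSI.
- move=> j; have := yK j.+1 I; rewrite GS => -[k _ [x xj xy]].
  by exists x; split => //; exists k.
have [_ [k _ xy]] := xB 0%N I.
by exists k => //; exists x => // j _; have [] := xB j I.
Qed.

End attractor.

Theorem corollary4p6 (R : realType) (n nu : nat)
    (s : 'I_nu -> 'rV[R]_n.-1 -> 'rV[R]_n.-1)
    (Gamma Gamma0 : set 'rV[R]_n.-1) (Gamma_ : nat -> set 'rV[R]_n.-1) :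
  n = 2%N \/ n = 3%N ->
  (2 <= nu)%N ->
  (forall k, contraction_map (s k)) ->
  is_attractor s Gamma ->
  Gamma0 !=set0 -> compact Gamma0 -> ifs_image s Gamma0 `<=` Gamma0 ->
  Gamma_ 0%N = Gamma0 -> (forall j, Gamma_ j.+1 = ifs_image s (Gamma_ j)) ->
  bvp_cvg Gamma_ Gamma.
Proof.
move=> _ nu2 cs attr n0 c0 s0 G0 GS.
have [clG dG GE] := attractor_bigcap (ltnW nu2)
  (fun k => contraction_continuous (cs k)) attr
  (eq_ind_r (fun A => A !=set0) n0 G0) (eq_ind_r (fun A => compact A) c0 G0)
  (eq_ind_r (fun A => ifs_image s A `<=` A) s0 G0) GS.
exact: bvp_cvg_nested.
Qed.
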